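(* Let $\mathrm C_\infty^{\mathrm{Lie}}$ be the convergence radius of the power series $\Theta^{\mathrm{Lie}}(x)=\sum_{k=1}^\infty \Theta_k^{\mathrm{Lie}}x^k$, where $\Theta_k^{\mathrm{Lie}}=\frac1{k!}\|\mu_k(Y_1,\ldots,Y_k)\|_{\ell^1}$ (the cumulative convergence radius of the Magnus expansion in the Banach--Lie setting). Then $$2.427<\mathrm C_\infty^{\mathrm{Lie}}\le 4 .$$
   Context: The Magnus commutator $\mu_k(X_1,\ldots,X_k)$ is the part of the formal noncommutative power series $\log(\exp(X_1)\cdots\exp(X_k))$ in which every variable $X_1,\ldots,X_k$ has multiplicity exactly $1$. It is known that $\mu_k(X_1,\ldots,X_k)$ is a Lie (commutator) polynomial, i.e. an element of the free Lie algebra on $X_1,\ldots,X_k$ (embedded in the free associative algebra via $[A,B]=AB-BA$). A Lie monomial is an iterated bracket of generators (the generators themselves included); $-M$ is also regarded as a Lie monomial when $M$ is. For an element $P$ of the free Lie algebra over $\mathbb R$ generated by $Y_1,Y_2,\ldots$, one sets $$\|P\|_{\ell^1}=\inf\Big\{\sum_j|\theta_j| : P=\sum_j\theta_jM_j \text{ (finite sum)},\ \theta_j\in\mathbb R,\ M_j \text{ Lie monomials}\Big\}.$$ *)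

(* Defs.v *)
From mathcomp Require Import all_boot all_order all_algebra finmap.
From mathcomp Require Import monalg.
From mathcomp Require Import all_classical all_reals all_analysis.

Set Implicit Arguments.
Unset Strict Implicit.
Unset Printing Implicit Defensive.

Import Order.TTheory GRing.Theory Num.Theory.
Import numFieldNormedType.Exports.

Local Open Scope classical_set_scope.
Local Open Scope ring_scope.

(* The letter i : nat stands for the variable Y_(i+1), so that nat indexes
   Y_1, Y_2, ... *)

(* Formal power series in noncommuting variables, as the function giving the
   coefficient of each word. *)
Definition ncseries (R : Type) := seq nat -> R.

Section NCSeries.
Variable R : fieldType.
Implicit Types f g : ncseries R.

Definition ncs_one : ncseries R := fun w => (w == [::])%:R.
Definition ncs_var (i : nat) : ncseries R := fun w => (w == [:: i])%:R.
Definition ncs_sub f g : ncseries R := fun w => f w - g w.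
Definition ncs_mul f g : ncseries R :=
  fun w => \sum_(i < (size w).+1) f (take i w) * g (drop i w).
Definition ncs_pow f n : ncseries R := iter n (ncs_mul f) ncs_one.

(* \sum_n a_n f^n, for f without constant term: f^n then has no term of degree
   less than n, so the terms n > size w do not contribute to the coefficient of
   w. *)
Definition ncs_comp (a : nat -> R) f : ncseries R :=
  fun w => \sum_(n < (size w).+1) a n * ncs_pow f n w.

Definition ncs_exp f : ncseries R := ncs_comp (fun n => n`!%:R^-1) f.

(* log g = \sum_(n >= 1) (-1)^(n+1) / n (g - 1)^n, for g with constant term 1;
   the coefficient of index n = 0 below vanishes since 0^-1 = 0. *)
Definition ncs_log g : ncseries R :=
  ncs_comp (fun n => (-1) ^+ n.+1 / n%:R) (ncs_sub g ncs_one).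

Definition log_prod_exp (k : nat) : ncseries R :=
  ncs_log (\big[ncs_mul/ncs_one]_(i < k) ncs_exp (ncs_var i)).

End NCSeries.

(* The free associative algebra on Y_1, Y_2, ..., which contains the free Lie
   algebra. *)
Notation free_algebra R := {malg R[{fmonom nat}]}.

Section FreeAlgebra.
Variable R : fieldType.

Definition gen (i : nat) : free_algebra R := << FMonom [:: i] >>.

(* mu_k(Y_1, ..., Y_k): the words in which each of Y_1, ..., Y_k occurs exactly
   once and no other variable occurs are the permutations of [0; ...; k-1]. *)
Definition magnus_commutator (k : nat) : free_algebra R :=
  \sum_(w <- permutations (iota 0 k)) << log_prod_exp R k w *g FMonom w >>.

Definition lie_bracket (a b : free_algebra R) : free_algebra R := a * b - b * a.

Inductive lie_monomial : free_algebra R -> Prop :=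
| lie_monomial_gen i : lie_monomial (gen i)
| lie_monomial_bracket a b :
    lie_monomial a -> lie_monomial b -> lie_monomial (lie_bracket a b)
| lie_monomial_opp a : lie_monomial a -> lie_monomial (- a).

End FreeAlgebra.

Section MagnusLie.
Variable R : realType.

(* The list s of pairs (theta_j, M_j) is a decomposition
   P = \sum_j theta_j M_j into Lie monomials. *)
Definition lie_decomposition (P : free_algebra R)
    (s : seq (R * free_algebra R)) : Prop :=
  (forall p, p \in s -> lie_monomial p.2) /\ P = \sum_(p <- s) p.1 *: p.2.

(* Equal to +oo exactly when P is not in the free Lie algebra. *)
Definition lie_l1norm (P : free_algebra R) : \bar R :=
  ereal_inf [set (\sum_(p <- s) `|p.1|)%:E | s in lie_decomposition P].

Definition ThetaLie (k : nat) : \bar R :=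
  if k is 0%N then 0%E
  else ((k`!%:R^-1)%:E * lie_l1norm (magnus_commutator R k))%E.

(* Supremum of the r >= 0 at which \sum_k a_k r^k converges absolutely. The
   coefficients may be infinite; an infinite coefficient of positive index
   makes the radius 0. *)
Definition convergence_radius (a : nat -> \bar R) : \bar R :=
  ereal_sup [set r%:E | r in
    [set r : R | 0 <= r /\
       (\sum_(0 <= k <oo) (`|a k| * (r ^+ k)%:E) < +oo)%E]].

Definition CLie : \bar R := convergence_radius ThetaLie.

End MagnusLie.

(* Main.v *)
From Stdlib Require Import BinNat.
Require Import Defs.
From HB Require Import structures.
From mathcomp Require Import all_boot all_order all_algebra finmap.
From mathcomp Require Import monalg.
From mathcomp Require Import all_classical all_reals all_analysis.
From mathcomp Require Import ring lra zify.

Set Implicit Arguments.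
Unset Strict Implicit.
Unset Printing Implicit Defensive.

Import Order.TTheory GRing.Theory Num.Theory.
Local Open Scope ring_scope.

(* Functions f on words are read as the derivatives at 0 of a formal function of
   parameters t_0, t_1, ..., so that the product obeys the Leibniz rule for the
   shift derivations D_t. The Chen series E, with D_t E = E Y_t, has
   a logarithm Z with D_t Z = \sum_n b_n ad(Z)^n Y_t, where
   x / (1 - exp (- x)) = \sum_n b_n x^n, and mu_k is the value of Z at the word
   k-1, ..., 0. By the Leibniz rule, a system of scalar differential equations
   for Z, ad(Z)^3 and ad(Z)^4 majorizes the l^1 norms. The gain over the single
   equation for Z comes from [ad Z, ad W] = ad [Z, W]: the derivative of ad(Z)^j
   along ad(Z)^n Y_t with n > 0 telescopes to two terms. The coefficients of the
   solution being nonnegative, its derivative is convex, so the trapezoidal rule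
   bounds it from above, and 25 steps reach x = 2.428.

   For the upper bound, the coefficient of a permutation with d descents in mu_k
   is (-1)^d d! (k-1-d)! / k!, of absolute value at least 1 / (k 2^(k-1)), whereas
   a Lie monomial of degree k is a signed sum of only 2^(k-1) words. Pairing mu_k
   with the signs of its coefficients gives Theta_k >= 1 / (k 4^(k-1)). *)

(** * The ring of functions on words *)

(** No differential equation is solved. The system is replaced by its Picard iterates from 0, which
    are polynomials with nonnegative coefficients: each iteration makes the majorants valid for one
    more word length, and a table of bounds at grid points is invariant under the iteration. Since
    an iterate is the integral of expressions in the previous one, the trapezoidal rule may use
    bounds at both ends of a step, although as a numerical scheme it would be implicit. Series
    identities are likewise taken modulo long words, so that every sum is finite. Orders 3 and 4 are
    tracked because telescoping turns the j terms of the Leibniz rule into two, which gains nothing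
    for j = 2. Other powers of ad(Z) are bounded by products of the majorants, and |b_n| <= 2
    rho^(n/2) for even n > 2 sums their contributions as geometric series of ratio rho^2 y4, usable
    only while this ratio stays below 1. Decreasing words isolate the multilinear part: on a word
    with distinct letters, the shuffle product encodes concatenation of words with complementary
    sets of letters. *)

Definition hser (A : Type) := seq nat -> A.

Definition hder (A : Type) (t : nat) (f : hser A) : hser A :=
  fun s => f (t :: s).

HB.instance Definition _ (A : Type) := gen_eqMixin (hser A).
HB.instance Definition _ (A : Type) := gen_choiceMixin (hser A).

Section HserZmodule.
Variable A : zmodType.
Implicit Types f g h : hser A.

Definition hadd f g : hser A := fun s => f s + g s.
Definition hopp f : hser A := fun s => - f s.
Definition hzero : hser A := fun=> 0.

Fact haddA : associative hadd.
Proof. by move=> f g h; apply/funext => s; rewrite /hadd addrA. Qed.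
Fact haddC : commutative hadd.
Proof. by move=> f g; apply/funext => s; rewrite /hadd addrC. Qed.
Fact hadd0 : left_id hzero hadd.
Proof. by move=> f; apply/funext => s; rewrite /hadd add0r. Qed.
Fact haddN : left_inverse hzero hopp hadd.
Proof. by move=> f; apply/funext => s; rewrite /hadd addNr. Qed.

HB.instance Definition _ :=
  GRing.isZmodule.Build (hser A) haddA haddC hadd0 haddN.

Lemma hserD f g s : (f + g) s = f s + g s. Proof. by []. Qed.
Lemma hserN f s : (- f) s = - f s. Proof. by []. Qed.
Lemma hserB f g s : (f - g) s = f s - g s. Proof. by []. Qed.
Lemma hser_sum I (r : seq I) P (F : I -> hser A) s :
  (\sum_(i <- r | P i) F i) s = \sum_(i <- r | P i) F i s.
Proof. by elim/big_rec2: _ => // i x y _ <-. Qed.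
Lemma hderD t : {morph @hder A t : f g / f + g}. Proof. by []. Qed.
Lemma hderB t : {morph @hder A t : f g / f - g}. Proof. by []. Qed.
Lemma hder_sum t I (r : seq I) (P : pred I) (F : I -> hser A) :
  hder t (\sum_(i <- r | P i) F i) = \sum_(i <- r | P i) hder t (F i).
Proof. by elim/big_rec2: _ => // i x y _ <-. Qed.

End HserZmodule.

Section HserRing.
Variable A : nzRingType.
Implicit Types f g h : hser A.

(* The shuffle product: [(f * g) s] sums [f u * g v] over all splittings of s
   into complementary subwords u, v. *)
Fixpoint hmul_at f g (s : seq nat) {struct s} : A :=
  if s is t :: s' then hmul_at (hder t f) g s' + hmul_at f (hder t g) s'
  else f [::] * g [::].

Definition hmul f g : hser A := hmul_at f g.

Definition hconst (x : A) : hser A := fun s => if s is [::] then x else 0.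

Lemma hder_const t x : hder t (hconst x) = 0. Proof. by []. Qed.

Fact hmulDl : left_distributive hmul +%R.
Proof.
move=> f g h; apply/funext => s; rewrite hserD.
elim: s f g h => [|t s IH] f g h /=; first by rewrite mulrDl.
by rewrite hderD !IH addrACA.
Qed.

Fact hmulDr : right_distributive hmul +%R.
Proof.
move=> f g h; apply/funext => s; rewrite hserD.
elim: s f g h => [|t s IH] f g h /=; first by rewrite mulrDr.
by rewrite hderD !IH addrACA.
Qed.

Fact hmul0l f : hmul 0 f = 0.
Proof. by apply: (addIr (hmul 0 f)); rewrite -hmulDl !add0r. Qed.

Fact hmul0r f : hmul f 0 = 0.
Proof. by apply: (addIr (hmul f 0)); rewrite -hmulDr !add0r. Qed.

Fact hder_mul t f g : hder t (hmul f g) = hmul (hder t f) g + hmul f (hder t g).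
Proof. by []. Qed.

Fact hmulA : associative hmul.
Proof.
move=> f g h; apply/funext => s.
elim: s f g h => [|t s IH] f g h; first by rewrite /= mulrA.
have E k l : hmul k l (t :: s) = hmul (hder t k) l s + hmul k (hder t l) s by [].
by rewrite !E !hder_mul hmulDl hmulDr !hserD -!IH addrA.
Qed.

Fact hmul1l : left_id (hconst 1) hmul.
Proof.
move=> f; apply/funext => s; elim: s f => [|t s IH] f /=; first by rewrite mul1r.
by rewrite hder_const hmul0l IH add0r.
Qed.

Fact hmul1r : right_id (hconst 1) hmul.
Proof.
move=> f; apply/funext => s; elim: s f => [|t s IH] f /=; first by rewrite mulr1.
by rewrite hder_const hmul0r IH addr0.
Qed.

Fact hconst1_neq0 : hconst 1 != 0 :> hser A.
Proof.
by apply/eqP => /(congr1 (fun f : hser A => f [::])) /eqP; rewrite oner_eq0.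
Qed.

HB.instance Definition _ := GRing.Zmodule_isNzRing.Build (hser A)
  hmulA hmul1l hmul1r hmulDl hmulDr hconst1_neq0.

Lemma hserM_nil f g : (f * g) [::] = f [::] * g [::]. Proof. by []. Qed.
Lemma hserM_cons f g t s :
  (f * g) (t :: s) = (hder t f * g) s + (f * hder t g) s.
Proof. by []. Qed.
Lemma hderM t f g : hder t (f * g) = hder t f * g + f * hder t g.
Proof. by []. Qed.
Lemma hder1 t : hder t 1 = 0 :> hser A. Proof. by []. Qed.

Lemma hderX t f n :
  hder t (f ^+ n) = \sum_(i < n) f ^+ i * hder t f * f ^+ (n.-1 - i).
Proof.
elim: n => [|n IH]; first by rewrite big_ord0.
rewrite exprSr hderM IH big_ord_recr /= subnn mulr1 mulr_suml; congr (_ + _).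
apply: eq_bigr => i _; rewrite -mulrA -exprSr -subSn; last first.
  by rewrite -ltnS (ltn_predK (ltn_ord i)).
by rewrite (ltn_predK (ltn_ord i)).
Qed.

End HserRing.

Section HserAlgebra.
Variables (R : nzRingType) (A : algType R).
Implicit Types (f g : hser A) (c : R).

Definition hscale c f : hser A := fun s => c *: f s.

Fact hscaleA c d f : hscale c (hscale d f) = hscale (c * d) f.
Proof. by apply/funext => s; rewrite /hscale scalerA. Qed.
Fact hscale1 : left_id 1 hscale.
Proof. by move=> f; apply/funext => s; rewrite /hscale scale1r. Qed.
Fact hscaleDr : right_distributive hscale +%R.
Proof. by move=> c f g; apply/funext => s; rewrite /hscale hserD scalerDr. Qed.
Fact hscaleDl f : {morph hscale^~ f : c d / c + d}.
Proof. by move=> c d; apply/funext => s; rewrite /hscale hserD scalerDl. Qed.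

HB.instance Definition _ := GRing.Zmodule_isLmodule.Build R (hser A)
  hscaleA hscale1 hscaleDr hscaleDl.

Lemma hserZ c f s : (c *: f) s = c *: f s. Proof. by []. Qed.
Lemma hderZ t c f : hder t (c *: f) = c *: hder t f. Proof. by []. Qed.

Fact hscaleAl c f g : c *: (f * g) = (c *: f) * g.
Proof.
apply/funext => s; rewrite hserZ.
elim: s f g => [|t s IH] f g; first by rewrite !hserM_nil hserZ scalerAl.
by rewrite !hserM_cons scalerDr !IH.
Qed.

HB.instance Definition _ := GRing.Lmodule_isLalgebra.Build R (hser A) hscaleAl.

Fact hscaleAr c f g : c *: (f * g) = f * (c *: g).
Proof.
apply/funext => s; rewrite hserZ.
elim: s f g => [|t s IH] f g; first by rewrite !hserM_nil hserZ scalerAr.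
by rewrite !hserM_cons scalerDr !IH.
Qed.

HB.instance Definition _ := GRing.Lalgebra_isAlgebra.Build R (hser A) hscaleAr.

End HserAlgebra.

Lemma triangle_sum (V : nmodType) (G : nat -> nat -> V) n :
  \sum_(j < n) \sum_(k < j.+1) G (j - k)%N k =
  \sum_(k < n) \sum_(i < n - k) G i k.
Proof.
elim: n => [|n IH]; first by rewrite !big_ord0.
rewrite big_ord_recr IH [in RHS]big_ord_recr /= subSnn big_ord1.
rewrite big_ord_recr /= subnn addrA -big_split; congr (_ + _) => /=.
by apply: eq_bigr => k _; rewrite subSn ?(ltnW (ltn_ord k)) // big_ord_recr.
Qed.

(** * Truncation by word length *)

Section HserOrder.
Variables (R : nzRingType) (A : algType R).
Implicit Types f g h : hser A.

Definition hord n f := forall s, (size s < n)%N -> f s = 0.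
Definition heq n f g := forall s, (size s < n)%N -> f s = g s.

Lemma hord_le m n f : (m <= n)%N -> hord n f -> hord m f.
Proof. by move=> mn of_ s /leq_trans /(_ mn) /of_. Qed.

Lemma hord0n f : hord 0 f. Proof. by []. Qed.

Lemma hordD n f g : hord n f -> hord n g -> hord n (f + g).
Proof. by move=> hf hg s ss; rewrite hserD hf // hg // addr0. Qed.

Lemma hordZ n c f : hord n f -> hord n (c *: f).
Proof. by move=> hf s ss; rewrite hserZ hf // scaler0. Qed.

Lemma hordN n f : hord n f -> hord n (- f).
Proof. by move=> hf s ss; rewrite hserN hf // oppr0. Qed.

Lemma hord_sum n I (r : seq I) (P : pred I) (F : I -> hser A) :
  (forall i, P i -> hord n (F i)) -> hord n (\sum_(i <- r | P i) F i).
Proof. by move=> h s ss; rewrite hser_sum big1 // => i Pi; exact: h. Qed.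

Lemma hord_der n t f : hord n.+1 f -> hord n (hder t f).
Proof. by move=> hf s ss; apply: hf. Qed.

Lemma hordM m n f g : hord m f -> hord n g -> hord (m + n) (f * g).
Proof.
move=> hf hg s; elim: s m n f g hf hg => [|t s IH] m n f g hf hg.
  rewrite hserM_nil /=; case: m hf => [|m] hf; last by rewrite hf ?mul0r.
  by case: n hg => [|n] hg //; rewrite hg ?mulr0.
rewrite hserM_cons /= => ss.
have -> : (hder t f * g) s = 0.
  case: m hf ss => [|m] hf ss; last by apply: (IH m n); first exact: hord_der.
  by apply: (IH 0 n) => //; apply: ltnW.
have -> : (f * hder t g) s = 0.
  case: n hg ss => [|n] hg ss; first by apply: (IH m 0) => //; apply: ltnW.
  by apply: (IH m n); rewrite // ?addnS // in ss *; exact: hord_der.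
by rewrite addr0.
Qed.

Lemma hordX n f : hord 1 f -> hord n (f ^+ n).
Proof.
move=> hf; elim: n => [|n IH]; first exact: hord0n.
by rewrite exprS -add1n; apply: hordM.
Qed.

Lemma heq_refl n f : heq n f f. Proof. by []. Qed.

Lemma heq_sym n f g : heq n f g -> heq n g f.
Proof. by move=> h s ss; rewrite h. Qed.

Lemma heq_trans n f g h : heq n f g -> heq n g h -> heq n f h.
Proof. by move=> h1 h2 s ss; rewrite h1 ?h2. Qed.

Lemma heq_le m n f g : (m <= n)%N -> heq n f g -> heq m f g.
Proof. by move=> mn h s /leq_trans /(_ mn) /h. Qed.

Lemma heqB n f g : heq n f g <-> hord n (f - g).
Proof.
split=> h s ss; first by rewrite hserB h // subrr.
by apply/eqP; rewrite -subr_eq0 -hserB h.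
Qed.

Lemma heqD n f g f' g' : heq n f f' -> heq n g g' -> heq n (f + g) (f' + g').
Proof. by move=> h1 h2 s ss; rewrite !hserD h1 ?h2. Qed.

Lemma heqZ n c f f' : heq n f f' -> heq n (c *: f) (c *: f').
Proof. by move=> h1 s ss; rewrite !hserZ h1. Qed.

Lemma heqN n f f' : heq n f f' -> heq n (- f) (- f').
Proof. by move=> h1 s ss; rewrite !hserN h1. Qed.

Lemma heq_sum n I (r : seq I) (P : pred I) (F G : I -> hser A) :
  (forall i, P i -> heq n (F i) (G i)) ->
  heq n (\sum_(i <- r | P i) F i) (\sum_(i <- r | P i) G i).
Proof. by move=> h s ss; rewrite !hser_sum; apply: eq_bigr => i Pi; exact: h. Qed.

Lemma heqM n f g f' g' : heq n f f' -> heq n g g' -> heq n (f * g) (f' * g').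
Proof.
move=> /heqB h1 /heqB h2; apply/heqB.
have -> : f * g - f' * g' = (f - f') * g + f' * (g - g').
  by rewrite mulrBl mulrBr addrA subrK.
by apply: hordD; [rewrite -[n]addn0|rewrite -[n]add0n]; apply: hordM.
Qed.

Lemma heqX n k f f' : heq n f f' -> heq n (f ^+ k) (f' ^+ k).
Proof.
move=> h; elim: k => [|k IH]; first exact: heq_refl.
by rewrite !exprS; apply: heqM.
Qed.

Lemma heq_der n t f g : heq n.+1 f g -> heq n (hder t f) (hder t g).
Proof. by move=> h s ss; apply: h. Qed.

(** A series with constant term 1 can be cancelled: g = f g - (f - 1) g, and the last product has
    order one more than is already known for g. *)
Lemma hord_unit n f g : hord 1 (f - 1) -> hord n (f * g) -> hord n g.
Proof.
move=> h1 h2; suff H m : (m <= n)%N -> hord m g by exact: H.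
elim: m => [|m IH] mn; first exact: hord0n.
have -> : g = f * g - (f - 1) * g by rewrite mulrBl mul1r subKr.
apply: hordD; first exact: hord_le h2.
by apply: hordN; rewrite -add1n; apply: hordM => //; apply: IH; exact: ltnW.
Qed.

End HserOrder.

(** * Commutators and powers of ad *)

Section HserComm.
Variables (R : comNzRingType) (A : algType R).
Implicit Types f g w x y z : hser A.

Definition hbr f g : hser A := f * g - g * f.

Lemma hbrDr f : {morph hbr f : x y / x + y}.
Proof. by move=> x y; rewrite /hbr mulrDr mulrDl opprD addrACA. Qed.
Lemma hbrDl x f g : hbr (f + g) x = hbr f x + hbr g x.
Proof. by rewrite /hbr mulrDr mulrDl opprD addrACA. Qed.
Lemma hbr0r f : hbr f 0 = 0. Proof. by rewrite /hbr mulr0 mul0r subr0. Qed.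
Lemma hbr0l f : hbr 0 f = 0. Proof. by rewrite /hbr mulr0 mul0r subr0. Qed.
Lemma hbrZr c f x : hbr f (c *: x) = c *: hbr f x.
Proof. by rewrite /hbr -scalerAr -scalerAl scalerBr. Qed.
Lemma hbrZl c f x : hbr (c *: f) x = c *: hbr f x.
Proof. by rewrite /hbr -scalerAr -scalerAl scalerBr. Qed.
Lemma hbr_sumr f I (r : seq I) (P : pred I) (F : I -> hser A) :
  hbr f (\sum_(i <- r | P i) F i) = \sum_(i <- r | P i) hbr f (F i).
Proof. by rewrite (big_morph _ (hbrDr f) (hbr0r f)). Qed.
Lemma hbr_suml x I (r : seq I) (P : pred I) (F : I -> hser A) :
  hbr (\sum_(i <- r | P i) F i) x = \sum_(i <- r | P i) hbr (F i) x.
Proof. by rewrite (big_morph _ (hbrDl x) (hbr0l x)). Qed.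
Lemma hder_br t f g : hder t (hbr f g) = hbr (hder t f) g + hbr f (hder t g).
Proof. by rewrite /hbr hderB !hderM opprD addrACA [X in _ + X]addrC addrACA
  [X in _ + X]addrC. Qed.

Lemma hbr_jacobi w x y : hbr (hbr w x) y = hbr w (hbr x y) - hbr x (hbr w y).
Proof.
rewrite /hbr !(mulrBl, mulrBr) !mulrA !(opprB, opprD, opprK) !addrA.
rewrite [RHS](ACl (1*8*3*6*(2*5)*(4*7)))%AC /=.
by rewrite !addNr !addr0.
Qed.

Definition had w n x : hser A := iter n (hbr w) x.

Lemma hadS w n x : had w n.+1 x = hbr w (had w n x). Proof. by []. Qed.
Lemma hadSr w n x : had w n.+1 x = had w n (hbr w x).
Proof. by rewrite /had iterSr. Qed.
Lemma had_add w m n x : had w (m + n) x = had w m (had w n x).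
Proof. by rewrite /had iterD. Qed.
Lemma hadDr w n : {morph had w n : x y / x + y}.
Proof. by move=> x y; elim: n => [|n IH] //; rewrite !hadS IH hbrDr. Qed.
Lemma had0 w n : had w n 0 = 0.
Proof. by elim: n => [|n IH] //; rewrite hadS IH hbr0r. Qed.
Lemma hadZ w n c x : had w n (c *: x) = c *: had w n x.
Proof. by elim: n => [|n IH] //; rewrite !hadS IH hbrZr. Qed.
Lemma had_sum w n I (r : seq I) (P : pred I) (F : I -> hser A) :
  had w n (\sum_(i <- r | P i) F i) = \sum_(i <- r | P i) had w n (F i).
Proof. by rewrite (big_morph _ (hadDr w n) (had0 w n)). Qed.

Lemma hordbr m n f g : hord m f -> hord n g -> hord (m + n) (hbr f g).
Proof.
move=> hf hg; apply: hordD; first exact: hordM.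
by apply: hordN; rewrite addnC; apply: hordM.
Qed.

Lemma hord_had w m n x : hord 1 w -> hord m x -> hord (n + m) (had w n x).
Proof.
move=> hw hx; elim: n => [|n IH]; first by rewrite add0n.
by rewrite hadS addSn -add1n; apply: hordbr.
Qed.

Lemma heq_br n f f' g g' : heq n f f' -> heq n g g' ->
  heq n (hbr f g) (hbr f' g').
Proof.
by move=> hf hg; apply: heqD; [apply: heqM|apply: heqN; apply: heqM].
Qed.

(** Truncated identities can be substituted inside iterated brackets. *)
Lemma heq_had n k w w' x x' : heq n w w' -> heq n x x' ->
  heq n (had w k x) (had w' k x').
Proof. by move=> hw hx; elim: k => [|k IH] //; apply: heq_br. Qed.

(** Right multiplication by w is left multiplication minus ad(w), and these two operators commute,
    so the binomial formula applies. *)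
Lemma mulr_exp_had w z n :
  z * w ^+ n = \sum_(k < n.+1) (-1) ^+ k *: (w ^+ (n - k) * had w k z) *+ 'C(n, k).
Proof.
elim: n => [|n IH]; first by rewrite big_ord1 /= bin0 mulr1n scale1r mul1r mulr1.
have swap k : had w k z * w = w * had w k z - had w k.+1 z.
  by rewrite hadS /hbr subKr.
rewrite exprSr mulrA IH mulr_suml.
under eq_bigr => k _.
  rewrite mulrnAl -scalerAl -mulrA swap mulrBr scalerBr mulrnBl.
  rewrite mulrA -exprSr -subSn; last by rewrite -ltnS.
  over.
rewrite sumrB [in RHS]big_ord_recl [X in X - _]big_ord_recl /= !bin0.
rewrite -addrA; congr (_ + _).
rewrite -sumrN big_ord_recr [in RHS]big_ord_recr /=.
under [in RHS]eq_bigr => k _ do rewrite /bump /= add1n binS mulrnDr.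
rewrite big_split /= !addrA -(big_split _ _ _ _) /=.
rewrite -big_split /=; congr (_ + _).
  apply: eq_bigr => i _.
  by rewrite /bump /= !add1n subSS exprS mulN1r !scaleNr !mulNrn.
by rewrite /bump /= !add1n subSS exprS mulN1r !scaleNr !mulNrn !binn.
Qed.

(** With L the left multiplication by w, both sides are (L^n - (L - ad w)^n) / ad w applied to z. *)
Lemma sum_expr_had w z n :
  \sum_(i < n) w ^+ i * z * w ^+ (n.-1 - i) =
  \sum_(k < n) (-1) ^+ k *: (w ^+ (n.-1 - k) * had w k z) *+ 'C(n, k.+1).
Proof.
elim: n => [|n IH]; first by rewrite !big_ord0.
rewrite big_ord_recl /= expr0 mul1r subn0 mulr_exp_had.
have -> : \sum_(i < n) w ^+ bump 0 i * z * w ^+ (n - bump 0 i) =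
          w * \sum_(i < n) w ^+ i * z * w ^+ (n.-1 - i).
  rewrite mulr_sumr; apply: eq_bigr => i _.
  by rewrite /bump /= add1n exprS !mulrA -subn1 -!subnDA.
rewrite IH mulr_sumr big_ord_recr [in RHS]big_ord_recr /= !subnn !expr0 !mul1r.
rewrite !binn addrAC -big_split; congr (_ + _) => /=.
apply: eq_bigr => i _; rewrite binS addnC mulrnDr; congr (_ + _).
rewrite mulrnAr -scalerAr mulrA -exprS.
by have -> : (n.-1 - i).+1 = (n - i)%N by have := ltn_ord i; lia.
Qed.

End HserComm.

(** * Exponential and logarithm *)

Section ExpLog.
Variables (R : numFieldType) (A : algType R).
Implicit Types (p q : {poly R}) (f w : hser A).

Definition log_coef (n : nat) : R := (-1) ^+ n.+1 / n%:R.

Definition log_poly N : {poly R} := \poly_(m < N.+1) log_coef m.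

Definition exp_log_poly N : {poly R} :=
  \sum_(j < N.+1) j`!%:R^-1 *: log_poly N ^+ j.

Lemma coef_exp_small p n i : p`_0 = 0 -> (i < n)%N -> (p ^+ n)`_i = 0.
Proof.
move=> p0; elim: n i => [|n IH] i //; rewrite exprS coefM => li.
rewrite big1 // => -[[|j] lj] _ /=; first by rewrite p0 mul0r.
by rewrite IH ?mulr0 //; lia.
Qed.

(** Truncation disturbs the chain rule only from degree N on: the polynomial l of the logarithm has
    no constant term, so that l^N starts in degree N, and (1 + X) l' = 1 below degree N. *)
Lemma exp_log_poly_deriv N i : (i < N)%N ->
  ((1 + 'X) * (exp_log_poly N)^`())`_i = (exp_log_poly N)`_i.
Proof.
move=> iN; set l := log_poly N; set e := exp_log_poly N.
have l0 : l`_0 = 0 by rewrite coef_poly /= /log_coef invr0 mulr0.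
have dl k : (k < N)%N -> ((1 + 'X) * l^`())`_k = (k == 0)%:R.
  move=> kN; rewrite mulrDl mul1r coefD coefXM !coef_deriv !coef_poly /=.
  have log_coefn m : log_coef m.+1 *+ m.+1 = (-1) ^+ m.
    rewrite -[LHS]mulr_natr /log_coef divfK ?pnatr_eq0 // !exprS.
    by rewrite !mulN1r opprK.
  rewrite ltnS kN log_coefn; case: k kN => [|k] kN //=; first by rewrite addr0.
  rewrite ltnS (ltnW kN) log_coefn exprS mulN1r addNr //.
have de : e^`() = (e - N`!%:R^-1 *: l ^+ N) * l^`().
  rewrite /e /exp_log_poly [in RHS]big_ord_recr /= addrK raddf_sum mulr_suml.
  rewrite big_ord_recl /= expr0 derivZ -polyC1 derivC scaler0 add0r.
  apply: eq_bigr => j _; rewrite derivZ deriv_exp -!scalerAl /bump /= add1n.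
  rewrite add0n -scalerMnr scalerMnl mulrC; congr (_ *: _).
  by rewrite factS natrM invfM -[LHS]mulr_natl mulrA divff ?mul1r ?pnatr_eq0.
rewrite de mulrCA coefM (bigD1 (Ordinal (ltnSn i))) //= subnn dl ?mulr1; last first.
  exact: leq_ltn_trans iN.
rewrite big1 ?addr0 => [|k kni].
  by rewrite coefB coefZ coef_exp_small ?mulr0 ?subr0.
have lk : (k < i)%N.
  by rewrite ltn_neqAle -ltnS ltn_ord andbT; apply: contra kni => /eqP ki; apply/eqP/val_inj.
by rewrite dl ?subn_eq0 1?leqNgt ?lk ?mulr0 //; lia.
Qed.

(** The differential equation reads (i + 1) e_(i+1) = (1 - i) e_i; starting from e_0 = 1 the
    recursion gives e_1 = 1 and stops at i = 1. *)
Lemma coef_exp_log_poly N i : (i <= N)%N ->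
  (exp_log_poly N)`_i = (1 + 'X : {poly R})`_i.
Proof.
have D k : (k < N)%N -> (exp_log_poly N)`_k.+1 *+ k.+1 =
    (exp_log_poly N)`_k - (exp_log_poly N)`_k *+ k.
  move=> kN; apply/eqP; rewrite eq_sym subr_eq -[X in X == _](exp_log_poly_deriv kN).
  rewrite mulrDl mul1r coefD coefXM !coef_deriv.
  by case: k kN => [|k] kN.
have E0 : (exp_log_poly N)`_0 = 1.
  rewrite coef_sum big_ord_recl big1 /= => [|j _].
    by rewrite expr0 coefZ coefC /= fact0 invr1 mulr1 addr0.
  by rewrite coefZ coef_exp_small ?mulr0 // coef_poly /= /log_coef invr0 mulr0.
case: i => [|i iN]; first by rewrite E0 coefD coefC coefX addr0.
have E1 : (exp_log_poly N)`_i.+1 = (i == 0)%:R.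
  elim: i iN => [|i IH] iN.
    apply: (pmulrnI (ltn0Sn 0)); rewrite /= [LHS](D _ iN).
    by rewrite E0 mulr0n subr0.
  apply: (pmulrnI (ltn0Sn i.+1)); rewrite /= [LHS](D _ iN) (IH (ltnW iN)).
  by case: (i) => [|k]; rewrite ?mulr1n ?subrr ?mul0rn ?subr0.
by rewrite E1 coefD coefC coefX add0r.
Qed.

Lemma horner_algZ f c p : horner_alg f (c *: p) = c *: horner_alg f p.
Proof. by rewrite -mul_polyC rmorphM /= horner_algC -scalerAl mul1r. Qed.

Lemma horner_alg_sum f p :
  horner_alg f p = \sum_(i < size p) p`_i *: f ^+ i.
Proof.
rewrite -[in LHS](coefK p) poly_def raddf_sum; apply: eq_bigr => i _.
by rewrite /= horner_algZ rmorphXn /= horner_algX.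
Qed.

Lemma hord_horner_alg n f p : hord 1 f -> (forall i, (i < n)%N -> p`_i = 0) ->
  hord n (horner_alg f p).
Proof.
move=> hf hp; rewrite horner_alg_sum; apply: hord_sum => i _.
case: (ltnP i n) => [/hp ->|ni]; first by rewrite scale0r.
by apply: hordZ; apply: hord_le ni _; apply: hordX.
Qed.

(** The series log (1 + f). For f of order 1, the powers beyond the length of s vanish at s. *)
Definition hlog f : hser A :=
  fun s => \sum_(m < (size s).+1) log_coef m *: (f ^+ m) s.

(** Cut at a fixed order, independent of the word, so that it is a polynomial in w and can be
    differentiated termwise. *)
Definition hexp N w : hser A := \sum_(j < N.+1) j`!%:R^-1 *: w ^+ j.

Lemma hlog_horner N f : hord 1 f ->
  heq N.+1 (hlog f) (horner_alg f (log_poly N)).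
Proof.
move=> hf s sN.
have -> : horner_alg f (log_poly N) = \sum_(m < N.+1) log_coef m *: f ^+ m.
  rewrite /log_poly poly_def raddf_sum; apply: eq_bigr => i _.
  by rewrite /= horner_algZ rmorphXn /= horner_algX.
rewrite hser_sum /hlog (big_ord_widen _ (fun m => log_coef m *: (f ^+ m) s) sN).
rewrite big_mkcond; apply: eq_bigr => m _; rewrite hserZ.
by case: ltnP => // sm; rewrite (hordX (n := m) hf) ?scaler0.
Qed.

Lemma hord_log f : hord 1 f -> hord 1 (hlog f).
Proof.
move=> hf s; case: s => // _.
by rewrite /hlog big_ord1 /log_coef invr0 mulr0 scale0r.
Qed.

Lemma hexp_log N f : hord 1 f -> heq N.+1 (hexp N (hlog f)) (1 + f).
Proof.
move=> hf; apply: (@heq_trans _ _ _ _ (horner_alg f (exp_log_poly N))).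
  rewrite /exp_log_poly raddf_sum; apply: heq_sum => j _.
  rewrite /= horner_algZ rmorphXn /=; apply: heqZ; apply: heqX; exact: hlog_horner.
apply/heqB; have -> : 1 + f = horner_alg f (1 + 'X).
  by rewrite rmorphD rmorph1 /= horner_algX.
rewrite -rmorphB; apply: hord_horner_alg => // i iN.
by rewrite coefB coef_exp_log_poly ?subrr.
Qed.

End ExpLog.

(** * Bernoulli numbers *)

Section Bernoulli.
Variable R : numFieldType.

(* The coefficients of B = x / (1 - exp (- x)), from the Riccati equation
   x B' = B - B^2 + x B. *)
Fixpoint bern_seq (n : nat) : seq R :=
  if n is m.+1 then
    let s := bern_seq m in
    rcons s (if m is k.+1 then
               (s`_k - \sum_(1 <= i < m) s`_i * s`_(m - i)) / m.+1%:R
             else 1)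
  else [::].

Definition bern n : R := (bern_seq n.+1)`_n.

Lemma size_bern_seq n : size (bern_seq n) = n.
Proof. by elim: n => //= n IH; rewrite size_rcons IH. Qed.

Lemma nth_bern_seq n i : (i < n)%N -> (bern_seq n)`_i = bern i.
Proof.
elim: n => // n IH; rewrite ltnS leq_eqVlt => /orP[/eqP ->//|lin].
by rewrite /= nth_rcons size_bern_seq lin IH.
Qed.

Lemma bern0 : bern 0 = 1. Proof. by []. Qed.

Lemma bernS n : n.+2%:R * bern n.+1 =
  bern n - \sum_(1 <= i < n.+1) bern i * bern (n.+1 - i).
Proof.
rewrite {1}/bern -/(bern_seq n.+1).
have -> : bern_seq n.+2 = rcons (bern_seq n.+1) (((bern_seq n.+1)`_n -
  \sum_(1 <= i < n.+1) (bern_seq n.+1)`_i * (bern_seq n.+1)`_(n.+1 - i)) / n.+2%:R) by [].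
rewrite nth_rcons size_bern_seq ltnn eqxx mulrC divfK ?pnatr_eq0 //.
rewrite nth_bern_seq //; congr (_ - _).
rewrite !big_nat; apply: eq_bigr => i /andP[i0 iN].
by rewrite !nth_bern_seq //; lia.
Qed.

Lemma bernS_conv n :
  n.+1%:R * bern n.+1 = bern n.+1 + bern n -
    \sum_(i < n.+2) bern i * bern (n.+1 - i).
Proof.
rewrite -(big_mkord xpredT (fun i => bern i * bern (n.+1 - i))).
rewrite big_nat_recr //= big_nat_recl //= subn0 subnn bern0 mul1r mulr1.
have -> : \sum_(0 <= i < n) bern i.+1 * bern (n.+1 - i.+1) =
          \sum_(1 <= i < n.+1) bern i * bern (n.+1 - i) by rewrite big_add1.
have := bernS n; rewrite -[n.+2]addn1 natrD => E.
have -> : n.+1%:R * bern n.+1 = (n.+1%:R + 1) * bern n.+1 - bern n.+1 by ring.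
by rewrite E; ring.
Qed.

(* The coefficients of E = (1 - exp (- x)) / x. *)
Definition ecoef (n : nat) : R := (-1) ^+ n / n.+1`!%:R.

Lemma ecoef0 : ecoef 0 = 1. Proof. by rewrite /ecoef expr0 divr1. Qed.

Lemma ecoefS n : n.+1%:R * ecoef n.+1 = - ecoef n - ecoef n.+1.
Proof.
have h : n.+2%:R * ecoef n.+1 = - ecoef n.
  rewrite /ecoef (factS n.+1) natrM invfM exprS mulN1r.
  by rewrite mulrCA [X in _ * X]mulrA divff ?pnatr_eq0 // mul1r mulNr.
by rewrite -h; ring.
Qed.

(* x E' = 1 - x E - E and x B' = B - B^2 + x B give x (EB)' = B (1 - EB),
   whence EB = 1. *)
Lemma bern_ecoef n : \sum_(i < n.+1) bern (n - i) * ecoef i = (n == 0)%:R.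
Proof.
set b : {poly R} := \poly_(i < n.+1) bern i.
set e : {poly R} := \poly_(i < n.+1) ecoef i.
have bE i : (i <= n)%N -> b`_i = bern i by move=> h; rewrite coef_poly ltnS h.
have eE i : (i <= n)%N -> e`_i = ecoef i by move=> h; rewrite coef_poly ltnS h.
have db i : (i <= n)%N -> ('X * b^`())`_i = (b - b * b + 'X * b)`_i.
  move=> iN; rewrite coefD coefB !coefXM coef_deriv coefM.
  case: i iN => [|i] iN /=.
    by rewrite big_ord1 subn0 bE // bern0 mulr1 subrr addr0.
  rewrite !bE ?(ltnW iN) // -[LHS]mulr_natl bernS_conv addrAC.
  congr (_ - _ + _); apply: eq_bigr => -[j lj] _ /=.
  by rewrite !bE //; lia.
have de i : (i <= n)%N -> ('X * e^`())`_i = (1 - 'X * e - e)`_i.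
  move=> iN; rewrite !coefB !coefXM coef_deriv coef1.
  case: i iN => [|i] iN /=.
    by rewrite eE // ecoef0 subr0 subrr.
  by rewrite !eE ?(ltnW iN) // -[LHS]mulr_natl ecoefS sub0r.
have congM (p p' q : {poly R}) i : (i <= n)%N ->
  (forall j, (j <= n)%N -> p`_j = p'`_j) -> (p * q)`_i = (p' * q)`_i.
  move=> iN h; rewrite !coefM; apply: eq_bigr => -[j lj] _ /=.
  by rewrite h //; lia.
have dg i : (i <= n)%N -> ('X * (e * b)^`())`_i = (b * (1 - e * b))`_i.
  move=> iN; have -> : 'X * (e * b)^`() = 'X * e^`() * b + 'X * b^`() * e.
    by rewrite derivM; ring.
  rewrite coefD (congM _ _ _ _ iN de) (congM _ _ _ _ iN db) -coefD.
  suff -> : (1 - 'X * e - e) * b + (b - b * b + 'X * b) * e = b * (1 - e * b) by [].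
  by ring.
have g0 : (e * b)`_0 = 1.
  by rewrite coefM big_ord1 eE // bE // ecoef0 bern0 mulr1.
have h i : (i <= n)%N -> (1 - e * b)`_i = 0.
  elim/ltn_ind: i => -[|i] IH iN; first by rewrite coefB coef1 g0 subrr.
  have := dg _ iN; rewrite coefXM coef_deriv /=.
  rewrite [X in _ = X -> _]coefM big_ord_recl /= subn0 bE // bern0 mul1r.
  rewrite big1 ?addr0 => [|j _]; last first.
    by rewrite IH ?mulr0 // /bump /=; lia.
  rewrite coefB coef1 /= sub0r => E; apply/eqP; rewrite oppr_eq0.
  have : (e * b)`_i.+1 *+ i.+2 = 0 by rewrite mulrSr E addNr.
  by move/eqP; rewrite mulrn_eq0.
have := h n (leqnn n); rewrite coefB => /eqP; rewrite subr_eq0 => /eqP.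
rewrite coef1 coefM => ->; apply: eq_bigr => -[j lj] _ /=.
by rewrite eE ?bE ?leq_subr // mulrC.
Qed.

End Bernoulli.

Section BernoulliBound.
Variable R : realFieldType.
Local Notation bern := (bern R).

Lemma bern1 : bern 1 = 1 / 2.
Proof.
have := @bernS R 0; rewrite big_geq // bern0 subr0.
by move=> E; lra.
Qed.

(** In the recursion, products with an odd index above 1 vanish by induction; the two products left,
    at the ends, carry the factor [bern 1] = 1/2 and together cancel the linear term. *)
Lemma bern_odd k : bern (k.*2.+3) = 0.
Proof.
elim/ltn_ind: k => k IH.
have odd0 i : odd i -> (1 < i)%N -> (i < k.*2.+3)%N -> bern i = 0.
  move=> oi i1 ik; have -> : i = ((i - 3)./2).*2.+3 by lia.
  by apply: IH; lia.
have := @bernS R k.*2.+2.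
rewrite big_nat_recr // big_nat_recl // big_nat big1 /=; last first.
  move=> i /andP[i1 iN]; case/boolP: (odd i) => oi.
    by rewrite [bern (_ - _)]odd0 ?mulr0 //; lia.
  by rewrite [bern i.+1]odd0 ?mul0r //; lia.
rewrite subSS subn0 subSn // subnn bern1 => E.
have {}E : k.*2.+4%:R * bern k.*2.+3 = 0 by rewrite E; lra.
by move/eqP: E; rewrite mulf_eq0 pnatr_eq0 /= => /eqP.
Qed.

Lemma bern2 : bern 2 = 1 / 12.
Proof.
have := @bernS R 1; rewrite big_nat1 bern1.
by move=> E; lra.
Qed.

Lemma sum_even (V : zmodType) (F : nat -> V) n : (forall k, F k.*2.+1 = 0) ->
  \sum_(1 <= i < n.+1.*2) F i = \sum_(1 <= j < n.+1) F j.*2.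
Proof.
move=> F0; elim: n => [|n IH].
  by rewrite [RHS]big_geq // big_nat1 -(F0 0%N).
rewrite doubleS big_nat_recr // big_nat_recr ?double_gt0 // IH /=.
by rewrite F0 addr0 [RHS]big_nat_recr.
Qed.

(** Euler's quadratic identity for the Bernoulli numbers, here divided by factorials. *)
Lemma bern_even_rec r : (1 < r)%N ->
  r.*2.+1%:R * bern r.*2 = - \sum_(1 <= j < r) bern j.*2 * bern (r - j).*2.
Proof.
case: r => [|[|r]] // _; rewrite doubleS.
rewrite (@bernS R r.+1.*2.+1) doubleS bern_odd sub0r -!doubleS; congr (- _).
rewrite (sum_even (F := fun i => bern i * bern (r.+2.*2 - i))).
  by apply: eq_bigr => j _; rewrite doubleB.
move=> [|k].
  have -> : (r.+2.*2 - 0.*2.+1 = r.*2.+3)%N by lia.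
  by rewrite bern_odd mulr0.
by rewrite doubleS bern_odd mul0r.
Qed.

Definition rho : R := 10 / 379.

(* The constant 2 is forced asymptotically, since |B_(2r)| ~ 2 / (2 pi)^(2r);
   the induction then goes through for any rho >= 1 / 42, and its base case
   r = 2 requires 720 * 2 * rho ^ 2 >= 1. *)
Lemma bern_even_bound r : (1 < r)%N -> `|bern r.*2| <= 2 * rho ^+ r.
Proof.
have rho0 : 0 < rho by rewrite /rho; lra.
elim/ltn_ind: r => r IH r1.
have rec : r.*2.+1%:R * `|bern r.*2| <=
           \sum_(1 <= j < r) `|bern j.*2| * `|bern (r - j).*2|.
  rewrite -[X in X * _]ger0_norm ?ler0n // -normrM bern_even_rec // normrN.
  apply: le_trans (ler_norm_sum _ _ _) _.
  by apply: ler_sum => j _; rewrite normrM.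
have b2 : `|bern 1.*2| = 1 / 12 by rewrite bern2 ger0_norm //; lra.
case: r IH r1 rec => [|[|[|r]]] // IH _.
  rewrite big_nat1 -[(2 - 1).*2%N]/(1.*2)%N !b2 -[2.*2.+1%N]/5%N expr2 /rho => h; lra.
move=> rec; rewrite -(ler_pM2l (x := r.+3.*2.+1%:R)) ?ltr0n //.
apply: (le_trans rec).
(* The end terms are split off because they contain [bern 2] = 1/12, which exceeds 2 rho and so
   escapes the bound being proved. *)
rewrite big_nat_recl // big_nat_recr //= subSS subn0 subSn // subnn b2.
have h1 : `|bern r.+2.*2| <= 2 * rho ^+ r.+2 by apply: IH.
have h2 : \sum_(1 <= i < r.+1) `|bern i.+1.*2| * `|bern (r.+3 - i.+1).*2| <=
          r%:R * (4 * rho ^+ r.+3).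
  rewrite -[X in X%:R * _](subn1 r.+1) mulr_natl -sumr_const_nat.
  rewrite !big_nat; apply: ler_sum => i /andP[i1 ir].
  have -> : 4 * rho ^+ r.+3 = (2 * rho ^+ i.+1) * (2 * rho ^+ (r.+3 - i.+1)).
    rewrite mulrACA -exprD subnKC; last by lia.
    by congr (_ * _); lra.
  by apply: ler_pM => //; apply: IH; lia.
have E : r.+3.*2.+1%:R = 2 * r%:R + 7 :> R.
  by rewrite -addnn -!addnS !natrD; ring.
have pr : 0 < rho ^+ r.+2 by rewrite exprn_gt0.
have r0 : 0 <= r%:R :> R by [].
rewrite big_add1 /= in h2 *.
rewrite E !(exprS _ r.+2) in h2 *; move: h1 h2 pr r0; clear.
set x := `|_|; set S := \sum_(0 <= i < r) _; set p := rho ^+ r.+2.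
by rewrite /rho; clearbody x S p; nra.
Qed.

End BernoulliBound.

(** * The derivative of a logarithm *)

Section LogDerivative.
Variables (R : numFieldType) (A : algType R).
Implicit Types (f w z : hser A).

(** The square contains in addition only terms with i + k >= N, which vanish on words shorter than
    N. *)
Lemma triangle_heq N (G : nat -> nat -> hser A) :
  (forall i k, hord (i + k) (G i k)) ->
  heq N (\sum_(j < N) \sum_(k < j.+1) G (j - k)%N k)
        (\sum_(k < N) \sum_(i < N) G i k).
Proof.
move=> hG; rewrite triangle_sum; apply: heq_sum => k _ s sN.
rewrite !hser_sum.
rewrite (big_ord_widen _ (fun i => G i k s) (leq_subr k N)) big_mkcond.
apply: eq_bigr => i _; case: ltnP => // Nik.
by rewrite (hG i k) //; lia.
Qed.

(** The formula for the differential of exp. The double sum factors because C(j+1, k+1) / (j+1)! = 1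
    / ((j-k)! (k+1)!); one order of truncation is lost to the derivative. *)
Lemma hder_hexp N t w : hord 1 w ->
  heq N.+1 (hder t (hexp N.+1 w))
    (hexp N w * \sum_(k < N.+1) ecoef R k *: had w k (hder t w)).
Proof.
move=> hw; set z := hder t w.
pose G i k := (i`!%:R^-1 *: w ^+ i) * (ecoef R k *: had w k z).
have hG i k : hord (i + k) (G i k).
  apply: hordM; apply: hordZ; first exact: hordX.
  by have := hord_had (n := k) hw (@hord0n _ _ z); rewrite addn0.
have -> : hder t (hexp N.+1 w) = \sum_(j < N.+1) \sum_(k < j.+1) G (j - k)%N k.
  rewrite /hexp big_ord_recl hderD hderZ expr0 hder1 scaler0 add0r hder_sum.
  apply: eq_bigr => j _; rewrite hderZ hderX sum_expr_had scaler_sumr /=.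
  apply: eq_bigr => k _.
  have lkj : (k <= j)%N by have := ltn_ord k.
  rewrite /G -scalerAl -scalerAr -scaler_nat !scalerA; congr (_ *: _).
  have /(congr1 (fun n => n%:R : R)) := bin_fact (n := j.+1) (m := k.+1) lkj.
  rewrite subSS natrM natrM /ecoef -[bump 0 j]/j.+1 => <-.
  have /negbTE c0 : 'C(j.+1, k.+1)%:R != 0 :> R.
    by rewrite pnatr_eq0 -lt0n bin_gt0.
  have f0 m : m`!%:R != 0 :> R by rewrite pnatr_eq0 -lt0n fact_gt0.
  have := f0 k.+1; have := f0 (j - k)%N; move: (k.+1)`! (j - k)`! => a b b0 a0.
by field; rewrite c0 b0 a0.
apply: heq_trans (triangle_heq hG) _.
rewrite exchange_big /hexp mulr_suml; apply: heq_sum => i _.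
by rewrite mulr_sumr; apply: heq_refl.
Qed.

(** Write Z for the logarithm. Both expressions for the derivative of exp(Z) have the left factor
    exp(Z); cancelling it leaves E(ad Z) D_t Z = x, and applying B(ad Z) inverts E. *)
Lemma hder_log N t f x : hord 1 f ->
  (hder t f = (1 + f) * hconst x) ->
  heq N (hder t (hlog f))
    (\sum_(n < N) bern R n *: had (hlog f) n (hconst x)).
Proof.
case: N => [//|N] hf df; set w := hlog f; set z := hder t w.
set y := hconst x : hser A in df *.
have hw : hord 1 w by apply: hord_log.
set S := \sum_(k < N.+1) ecoef R k *: had w k z.
have hS : heq N.+1 S y.
  apply/heqB/(hord_unit (f := hexp N w)).
    have -> : hexp N w - 1 = \sum_(j < N) j.+1`!%:R^-1 *: w ^+ j.+1.
      rewrite /hexp big_ord_recl expr0 fact0 invr1 scale1r addrC addKr.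
      by apply: eq_bigr => j _.
    apply: hord_sum => j _; apply: hordZ.
    by apply: hord_le (hordX (n := j.+1) hw).
  rewrite mulrBr; apply: (heqB _ _ _).1.
  apply: (@heq_trans _ _ _ _ (hder t (hexp N.+1 w))).
    by apply: heq_sym; apply: hder_hexp.
  have h : heq N.+1 (hder t (hexp N.+1 w)) (hder t (1 + f)).
    by apply: heq_der; apply: hexp_log.
  rewrite hderD hder1 add0r in h.
  apply: heq_trans h _; rewrite df.
  by apply: heqM => //; apply: heq_sym; exact: hexp_log.
apply: heq_sym.
apply: (@heq_trans _ _ _ _ (\sum_(n < N.+1) bern R n *: had w n S)).
  by apply: heq_sum => n _; apply: heqZ; apply: heq_had => //; exact: heq_sym.
pose G i k := bern R i *: (ecoef R k *: had w (i + k) z).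
have hG i k : hord (i + k) (G i k).
  by do 2![apply: hordZ]; have := hord_had (n := (i + k)%N) hw (@hord0n _ _ z); rewrite addn0.
apply: (@heq_trans _ _ _ _ (\sum_(k < N.+1) \sum_(i < N.+1) G i k)).
  rewrite exchange_big /=; apply: heq_sum => i _; rewrite /S had_sum scaler_sumr.
  by apply: heq_sum => k _; rewrite hadZ -had_add.
apply: heq_trans (heq_sym (triangle_heq hG)) _.
suff -> : \sum_(j < N.+1) \sum_(k < j.+1) G (j - k)%N k = z by [].
transitivity (\sum_(j < N.+1) (j == 0 :> nat)%:R *: had w j z).
  apply: eq_bigr => j _; rewrite -bern_ecoef scaler_suml.
  apply: eq_bigr => k _; rewrite /G scalerA subnK //.
  by have := ltn_ord k.
rewrite big_ord_recl scale1r big1 ?addr0 // => j _.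
by rewrite scale0r.
Qed.

End LogDerivative.

(** * Majorants of Lie series *)

Section MalgAlgebra.
Variables (R : comNzRingType) (K : monomType).

Lemma malgZU (c d : R) (k : K) : c *: << d *g k >> = << c * d *g k >>.
Proof. by apply/malgP => j; rewrite mcoeffZ !mcoeffU mulrnAr. Qed.

Lemma malgUM (c d : R) (j k : K) :
  << c *g j >> * << d *g k >> = << c * d *g mmul j k >>.
Proof. by rewrite malgM_def fgmulUU. Qed.

Lemma malg_scalerAr (c : R) (x y : {malg R[K]}) : c *: (x * y) = x * (c *: y).
Proof.
rewrite (monalgE x) (monalgE y) !mulr_suml scaler_sumr.
apply: eq_bigr => i _; rewrite [X in c *: X]mulr_sumr !scaler_sumr mulr_sumr.
by apply: eq_bigr => j _; rewrite !malgZU !malgUM malgZU mulrCA.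
Qed.

End MalgAlgebra.

(* An alias, because [{malg R[K]}] already carries a canonical algebra structure
   that is restricted to commutative monomials. *)
Definition falg (R : realType) : Type := free_algebra R.

HB.instance Definition _ (R : realType) :=
  GRing.Lalgebra.copy (falg R) (free_algebra R).
HB.instance Definition _ (R : realType) :=
  GRing.Lalgebra_isAlgebra.Build R (falg R)
    (@malg_scalerAr R {fmonom nat} : forall a (x y : falg R), a *: (x * y) = x * (a *: y)).

Section LieCost.
Variable R : realType.
Implicit Types (P Q : free_algebra R) (c d : R).

(** An explicit decomposition instead of a bound on the infimum, so that sums and brackets combine
    without approximation. *)
Definition lcost P c :=
  exists2 s, lie_decomposition P s & \sum_(p <- s) `|p.1| <= c.

Lemma lcost0 c : 0 <= c -> lcost 0 c.
Proof. by move=> c0; exists [::]; [split=> //|]; rewrite big_nil. Qed.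

Lemma lcost_monomial P : lie_monomial P -> lcost P 1.
Proof.
move=> mP; exists [:: (1, P)]; last by rewrite big_seq1 normr1.
by split; [move=> p; rewrite inE => /eqP ->|rewrite big_seq1 scale1r].
Qed.

Lemma lcostD P Q c d : lcost P c -> lcost Q d -> lcost (P + Q) (c + d).
Proof.
move=> [s [ms ->] sc] [r [mr ->] rd]; exists (s ++ r).
  split; last by rewrite big_cat.
  by move=> p; rewrite mem_cat => /orP[/ms|/mr].
by rewrite big_cat lerD.
Qed.

Lemma lcostZ a P c : lcost P c -> lcost (a *: P) (`|a| * c).
Proof.
move=> [s [ms ->] sc]; exists [seq (a * p.1, p.2) | p <- s].
  split; first by move=> p /mapP[q /ms mq ->].
  by rewrite scaler_sumr big_map; apply: eq_bigr => p _; rewrite scalerA.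
rewrite big_map; under eq_bigr => p _ do rewrite normrM.
by rewrite -mulr_sumr ler_wpM2l.
Qed.

Lemma lcostN P c : lcost P c -> lcost (- P) c.
Proof. by move=> /(lcostZ (-1)); rewrite normrN1 mul1r scaleN1r. Qed.

Lemma mul_sum_comm (B : pzRingType) I J (r : seq I) (s : seq J) (F : I -> B) (G : J -> B) :
  (\sum_(i <- r) F i) * (\sum_(j <- s) G j) - (\sum_(j <- s) G j) * (\sum_(i <- r) F i) =
  \sum_(i <- r) \sum_(j <- s) (F i * G j - G j * F i).
Proof.
rewrite !mulr_suml; under [X in _ - X]eq_bigr do rewrite mulr_sumr.
rewrite [X in _ - X]exchange_big /= -sumrB; apply: eq_bigr => i _.
by rewrite mulr_sumr -sumrB.
Qed.

Lemma lie_bracketZ c d P Q :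
  (c *: P) * (d *: Q) - (d *: Q) * (c *: P) = (c * d) *: lie_bracket P Q.
Proof.
by rewrite -!scalerAl -!malg_scalerAr !scalerA scalerBr [d * c]mulrC.
Qed.

Lemma lcost_bracket P Q c d :
  lcost P c -> lcost Q d -> lcost (lie_bracket P Q) (c * d).
Proof.
move=> [s [ms ->] sc] [r [mr ->] rd].
exists [seq (p.1 * q.1, lie_bracket p.2 q.2) | p <- s, q <- r].
  split; first by move=> _ /allpairsP[p [/ms h1 /mr h2 ->]]; exact: lie_monomial_bracket.
  rewrite [RHS]big_allpairs_dep [LHS]mul_sum_comm; apply: eq_bigr => p _.
  apply: eq_bigr => q _; exact: lie_bracketZ.
rewrite big_allpairs_dep /=; under eq_bigr => p _.
  under eq_bigr => q _ do rewrite normrM.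
  rewrite -mulr_sumr; over.
rewrite -mulr_suml; apply: ler_pM => //; exact: sumr_ge0.
Qed.

End LieCost.

Section Majorants.
Variable R : realType.
Local Notation A := (falg R).
Implicit Types (f g : hser A) (p q : {poly R}) (T S : hser A -> hser A).

(* The polynomial p is an exponential generating function, so that [maj_br] is a
   product. *)
Definition maj N f p :=
  forall s, (size s <= N)%N -> lcost (f s : free_algebra R) ((size s)`!%:R * p`_(size s)).

Lemma maj_le M N f p : (M <= N)%N -> maj N f p -> maj M f p.
Proof. by move=> MN h s sM; apply: h; exact: leq_trans MN. Qed.

Lemma maj_heq N f g p : heq N.+1 f g -> maj N g p -> maj N f p.
Proof. by move=> fg h s sN; rewrite fg //; apply: h. Qed.

Lemma maj0 N p : (forall i, 0 <= p`_i) -> maj N 0 p.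
Proof. by move=> h s _; apply: lcost0; rewrite mulr_ge0. Qed.

Lemma maj_const N x : lcost x 1 -> maj N (hconst x) 1.
Proof.
move=> hx [|t s] _; first by rewrite coef1 mulr1.
by rewrite coef1 mulr0; apply: lcost0.
Qed.

Lemma majD N f g p q : maj N f p -> maj N g q -> maj N (f + g) (p + q).
Proof.
by move=> hf hg s sN; rewrite coefD mulrDr; apply: lcostD; [apply: hf|apply: hg].
Qed.

Lemma majN N f p : maj N f p -> maj N (- f) p.
Proof. by move=> hf s sN; apply: lcostN; apply: hf. Qed.

Lemma majZ N a f p : maj N f p -> maj N (a *: f) (`|a| *: p).
Proof. by move=> hf s sN; rewrite coefZ mulrCA; apply: lcostZ; apply: hf. Qed.

Lemma maj_sum N n (F : 'I_n -> hser A) (p : 'I_n -> {poly R}) :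
  (forall i, maj N (F i) (p i)) -> maj N (\sum_(i < n) F i) (\sum_(i < n) p i).
Proof.
elim: n F p => [|n IH] F p h.
  by rewrite !big_ord0; apply: maj0 => i; rewrite coef0.
by rewrite !big_ord_recl; apply: majD => //; apply: IH.
Qed.

Lemma fact_coef_deriv p n :
  n`!%:R * p^`()`_n = n.+1`!%:R * p`_n.+1.
Proof. by rewrite coef_deriv factS natrM [LHS]mulrnAr -[LHS]mulr_natl mulrA. Qed.

Lemma maj_der N t f p : maj N.+1 f p -> maj N (hder t f) p^`().
Proof.
move=> h s sN; have := h (t :: s) sN.
by rewrite fact_coef_deriv.
Qed.

Lemma maj_rec N f p : lcost (f [::]) p`_0 ->
  (forall t, maj N (hder t f) p^`()) -> maj N.+1 f p.
Proof.
move=> h0 h [|t s] sN; first by rewrite fact0 mul1r.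
have := h t s sN.
by rewrite fact_coef_deriv.
Qed.

(** The Leibniz rule for the bracket has the same shape as the one for (p q)', so only the empty
    word needs a direct estimate. *)
Lemma maj_br N f g p q : maj N f p -> maj N g q -> maj N (hbr f g) (p * q).
Proof.
have nil (M : nat) f' g' p' q' : maj M f' p' -> maj M g' q' ->
    lcost (hbr f' g' [::]) (p' * q')`_0.
  move=> hf hg; rewrite coefM big_ord1.
  have := lcost_bracket (hf [::] isT) (hg [::] isT).
  by rewrite fact0 !mul1r.
elim: N f g p q => [|N IH] f g p q hf hg.
  by case=> [|//] _; rewrite fact0 mul1r; apply: nil hf hg.
apply: maj_rec => [|t]; first exact: nil hf hg.
rewrite hder_br derivM; apply: majD.
  by apply: IH; [apply: maj_der|apply: maj_le hg].
by apply: IH; [apply: maj_le hf|apply: maj_der].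
Qed.

(** All truncation orders n <= N are included because each differentiation of the argument lowers
    the order by one. *)
Definition opmaj N T p :=
  forall n f q, (n <= N)%N -> maj n f q -> maj n (T f) (p * q).

Lemma opmaj_id N : opmaj N id 1.
Proof. by move=> n f q _; rewrite mul1r. Qed.

Lemma opmaj_comp N T S p q :
  opmaj N T p -> opmaj N S q -> opmaj N (fun f => T (S f)) (p * q).
Proof. by move=> hT hS n f r nN h; rewrite -mulrA; apply: hT => //; apply: hS. Qed.

Lemma opmajB N T S p q :
  opmaj N T p -> opmaj N S q -> opmaj N (fun f => T f - S f) (p + q).
Proof.
move=> hT hS n f r nN h; rewrite mulrDl; apply: majD; first exact: hT.
by apply: majN; apply: hS.
Qed.

Lemma opmaj_sum N n (F : 'I_n -> hser A -> hser A) (p : 'I_n -> {poly R}) :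
  (forall i, opmaj N (F i) (p i)) ->
  opmaj N (fun f => \sum_(i < n) F i f) (\sum_(i < n) p i).
Proof.
by move=> h m f q mN hf; rewrite mulr_suml; apply: maj_sum => i; apply: h.
Qed.

Lemma opmaj_br N w p : maj N w p -> opmaj N (hbr w) p.
Proof. by move=> h n f q nN hf; apply: maj_br => //; exact: maj_le h. Qed.

End Majorants.

(** * Derivatives of powers of ad *)

Section HadDerivative.
Variables (R : comNzRingType) (A : algType R).
Implicit Types (f w x y z : hser A).

(** The derivative of ad(w)^j in the direction z, applied to x. *)
Definition had_diff w j z x : hser A :=
  \sum_(i < j) had w i (hbr z (had w (j.-1 - i) x)).

Lemma hder_had t w j x :
  hder t (had w j x) = had_diff w j (hder t w) x + had w j (hder t x).
Proof.
elim: j => [|j IH]; first by rewrite /had_diff big_ord0 add0r.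
rewrite hadS hder_br IH hbrDr /had_diff big_ord_recl /= subn0 addrA.
congr (_ + _ + _); rewrite hbr_sumr; apply: eq_bigr => i _.
rewrite /bump /= add1n add0n.
by have -> : (j.-1 - i = j - i.+1)%N by have := ltn_ord i; lia.
Qed.

Lemma had_diff_br w j y x :
  had_diff w j (hbr w y) x = had w j (hbr y x) - hbr y (had w j x).
Proof.
pose g i := had w i (hbr y (had w (j - i) x)).
have -> : had w j (hbr y x) - hbr y (had w j x) = g j - g 0%N.
  by rewrite /g subnn subn0.
rewrite -(telescope_sumr _ (leq0n j)) big_mkord; apply: eq_bigr => i _.
(* The Jacobi identity turns the summand of index i into g (i + 1) - g i. *)
rewrite hbr_jacobi hadDr -scaleN1r hadZ scaleN1r /g hadSr -hadS.
have -> : (j.-1 - i = j - i.+1)%N by have := ltn_ord i; lia.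
by have -> : ((j - i.+1).+1 = j - i)%N by have := ltn_ord i; lia.
Qed.

Lemma had_diff_sum w j x I (r : seq I) (P : pred I) (F : I -> hser A) :
  had_diff w j (\sum_(i <- r | P i) F i) x =
  \sum_(i <- r | P i) had_diff w j (F i) x.
Proof.
rewrite /had_diff [RHS]exchange_big; apply: eq_bigr => i _ /=.
by rewrite hbr_suml had_sum.
Qed.

Lemma had_diffZ w j c z x : had_diff w j (c *: z) x = c *: had_diff w j z x.
Proof.
by rewrite /had_diff scaler_sumr; apply: eq_bigr => i _; rewrite hbrZl hadZ.
Qed.

Lemma heq_had_diff N w j z z' x :
  heq N z z' -> heq N (had_diff w j z x) (had_diff w j z' x).
Proof.
by move=> h; apply: heq_sum => i _; apply: heq_had => //; apply: heq_br.
Qed.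

Lemma hmul_const f (a : A) s : (f * hconst a) s = f s * a.
Proof.
elim: s f => [|t s IH] f //.
by rewrite hserM_cons hder_const IH mulr0 addr0.
Qed.

End HadDerivative.

Section Integ.
Variable R : numFieldType.
Implicit Types p : {poly R}.

Definition integ p : {poly R} := \poly_(i < (size p).+1) (p`_i.-1 / i%:R).

Lemma integ0 p : (integ p)`_0 = 0.
Proof. by rewrite coef_poly /= invr0 mulr0. Qed.

Lemma deriv_integ p : (integ p)^`() = p.
Proof.
apply/polyP => i; rewrite coef_deriv coef_poly ltnS.
case: ltnP => ip; last by rewrite mul0rn nth_default.
by rewrite -[LHS]mulr_natr divfK // pnatr_eq0.
Qed.

End Integ.

(** * The recursion for the majorants *)

Section Recursion.
Variable R : realType.
Local Notation A := (falg R).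
Local Notation bern := (bern R).
Implicit Types (p q : {poly R}) (f : hser A).

Lemma word_nil : << FMonom [::] >> = 1 :> free_algebra R.
Proof.
rewrite -mpolyC1E; congr << 1 *g _ >>; apply/eqP.
by rewrite fmP fm1.
Qed.

Lemma word_cat (c d : R) (u v : seq nat) :
  << c *g FMonom u >> * << d *g FMonom v >> =
  << c * d *g FMonom (u ++ v) >> :> free_algebra R.
Proof.
rewrite malgUM; congr << _ *g _ >>; apply/eqP.
by rewrite fmP fmM.
Qed.

(* The Chen series; on strictly decreasing words it agrees with the product
   exp (t_0 Y_0) exp (t_1 Y_1) ... *)
Definition exp_prod : hser A := fun s => << FMonom (rev s) >> : free_algebra R.

Definition magnus : hser A := hlog (exp_prod - 1).

Lemma hord_exp_prod : hord 1 (exp_prod - 1).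
Proof.
case=> // _; rewrite hserB.
by rewrite /exp_prod /= [X in X - _]word_nil; exact: subrr.
Qed.

(** Prepending t to s appends t to the reversed word, so Y_t comes out as a factor on the right. *)
Lemma hder_exp_prod t :
  hder t (exp_prod - 1) = (1 + (exp_prod - 1)) * hconst (gen R t : A).
Proof.
apply/funext => s; rewrite [1 + _]addrC subrK hmul_const hderB hder1 subr0.
by rewrite /hder /exp_prod rev_cons -cats1 /gen [RHS]word_cat mulr1.
Qed.

Lemma hord_magnus : hord 1 magnus.
Proof. exact: hord_log hord_exp_prod. Qed.

Lemma hder_magnus N t : heq N (hder t magnus)
  (\sum_(n < N) bern n *: had magnus n (hconst (gen R t : A))).
Proof. exact: hder_log hord_exp_prod (hder_exp_prod t). Qed.

Definition state := ({poly R} * {poly R} * {poly R})%type.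

(* Majorant of [had magnus n], given the majorants for n = 1, 3, 4. *)
Definition had_maj (P : state) (n : nat) : {poly R} :=
  P.2 ^+ (n %/ 4) * nth 0 [:: 1; P.1.1; P.1.1 ^+ 2; P.1.2] (n %% 4).

Definition rhs1 M (P : state) : {poly R} :=
  \sum_(n < M) `|bern n| *: had_maj P n.

(** In the derivative of ad(Z)^j, the term Y_t of D_t Z yields the j Leibniz summands. A later term
    is a bracket [Z, ad(Z)^n Y_t] with coefficient b_(n+1) and yields two telescoped terms with
    equal majorants, whence the factor 2. *)
Definition rhs M j (P : state) : {poly R} :=
  \sum_(i < j) had_maj P i * had_maj P (j.-1 - i) +
  had_maj P j * (2 *: \sum_(n < M.-1) `|bern n.+1| *: had_maj P n).

(** One Picard step of the differential system, its Bernoulli series cut at M. *)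
Definition next M (P : state) : state :=
  (integ (rhs1 M P), integ (rhs M 3 P), integ (rhs M 4 P)).

Definition majorized N (P : state) :=
  [/\ maj N magnus P.1.1, opmaj N (had magnus 3) P.1.2 &
      opmaj N (had magnus 4) P.2].

Lemma opmaj_had N P n : majorized N P -> opmaj N (had magnus n) (had_maj P n).
Proof.
move=> [m1 m3 m4]; rewrite /had_maj.
have h4 k : opmaj N (had magnus (4 * k)) (P.2 ^+ k).
  elim: k => [|k IH]; first by rewrite expr0; exact: opmaj_id.
  rewrite exprS => i f q iN hf; rewrite mulnS had_add.
  by have := opmaj_comp m4 IH iN hf.
have hr r : (r < 4)%N ->
    opmaj N (had magnus r) (nth 0 [:: 1; P.1.1; P.1.1 ^+ 2; P.1.2] r).
  case: r => [|[|[|[|]]]] //= _.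
  - exact: opmaj_id.
  - exact: opmaj_br.
  - rewrite expr2; move=> i f q iN hf.
    exact: (opmaj_comp (opmaj_br m1) (opmaj_br m1) iN hf).
have /hr hm := ltn_pmod n (isT : 0 < 4)%N.
rewrite {1}(divn_eq n 4) mulnC => i f q iN hf; rewrite had_add.
exact: (opmaj_comp (h4 _) hm iN hf).
Qed.

Lemma lcost_gen t : lcost (gen R t) 1.
Proof. exact: lcost_monomial (lie_monomial_gen R t). Qed.

Lemma maj_had_gen N P n t : majorized N P ->
  maj N (had magnus n (hconst (gen R t : A))) (had_maj P n).
Proof.
move=> hP; rewrite -[had_maj P n]mulr1.
by apply: (opmaj_had n hP (leqnn N)); apply: maj_const; apply: lcost_gen.
Qed.

Lemma maj_hder_magnus N M P t : (N < M)%N -> majorized N P ->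
  maj N (hder t magnus) (rhs1 M P).
Proof.
move=> NM hP; apply: (maj_heq (heq_le NM (@hder_magnus M t))).
by apply: maj_sum => n; apply: majZ; apply: maj_had_gen.
Qed.

Lemma opmaj_had_diff N M P t j : (N < M)%N -> majorized N P ->
  opmaj N (had_diff magnus j (hder t magnus)) (rhs M j P).
Proof.
case: M => [//|M] NM hP n f q nN hf.
apply: (@maj_heq _ _ _ (\sum_(i < M.+1) bern i *: had_diff magnus j
          (had magnus i (hconst (gen R t : A))) f)).
  apply: (@heq_trans _ _ _ _ (had_diff magnus j (\sum_(i < M.+1)
            bern i *: had magnus i (hconst (gen R t : A))) f)).
    apply: heq_had_diff; apply: (heq_le _ (@hder_magnus M.+1 t)).
    exact: leq_ltn_trans NM.
  by rewrite had_diff_sum; apply: heq_sum => i _; rewrite had_diffZ.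
rewrite big_ord_recl bern0 scale1r /rhs mulrDl.
apply: majD.
  have h : opmaj N (had_diff magnus j (had magnus 0 (hconst (gen R t : A))))
             (\sum_(i < j) had_maj P i * had_maj P (j.-1 - i)).
    apply: opmaj_sum => i; apply: opmaj_comp; first exact: opmaj_had.
    rewrite -[had_maj P (j.-1 - i)]mul1r; apply: opmaj_comp; last exact: opmaj_had.
    by apply: opmaj_br; apply: maj_const; apply: lcost_gen.
  exact: h nN hf.
have -> : had_maj P j * (2 *: \sum_(n < M) `|bern n.+1| *: had_maj P n) * q =
    \sum_(i < M) `|bern i.+1| *:
      ((had_maj P j * had_maj P i + had_maj P i * had_maj P j) * q).
  rewrite scaler_sumr mulr_sumr mulr_suml; apply: eq_bigr => i _.
  by rewrite -!mul_polyC; ring.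
apply: maj_sum => i; apply: majZ; rewrite lift0 hadS.
have hY : opmaj N (hbr (had magnus i (hconst (gen R t : A)))) (had_maj P i).
  by apply: opmaj_br; apply: maj_had_gen.
have hj := opmaj_had j hP.
apply: maj_heq (opmajB (opmaj_comp hj hY) (opmaj_comp hY hj) nN hf).
by move=> s _; rewrite had_diff_br.
Qed.

Lemma majorized0 : majorized 0 (0, 0, 0).
Proof.
have had0' j : (0 < j)%N -> opmaj 0 (had magnus j) 0.
  move=> j0 n f q; rewrite leqn0 => /eqP -> _ [|//] _.
  rewrite (_ : had magnus j f [::] = 0) ?mul0r ?coef0 ?mulr0; first exact: lcost0.
  apply: (hord_had (n := j) (m := 0) hord_magnus); first exact: hord0n.
  by rewrite addn0.
split; [|exact: had0'..] => -[|//] _.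
by rewrite coef0 mulr0 hord_magnus //; apply: lcost0.
Qed.

(** On the empty word ad(Z)^j gives 0 because Z has order 1. On longer words the Leibniz rule leaves
    the derivative of ad(Z)^j, covered by the hypothesis, and ad(Z)^j applied to a derivative, where
    the order is one less. *)
Lemma opmaj_had_step N j p : (0 < j)%N -> p`_0 = 0 ->
  (forall t, opmaj N (had_diff magnus j (hder t magnus)) p^`()) ->
  opmaj N.+1 (had magnus j) p.
Proof.
move=> j0 p0 h n; elim: n => [|n IH] f q nN hf.
  case=> [|//] _; rewrite coefM big_ord1 p0 mul0r mulr0.
  rewrite (_ : had magnus j f [::] = 0); first exact: lcost0.
  apply: (hord_had (n := j) (m := 0) hord_magnus); first exact: hord0n.
  by rewrite addn0.
apply: maj_rec => [|t].
  rewrite coefM big_ord1 p0 mul0r.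
  rewrite (_ : had magnus j f [::] = 0); first exact: lcost0.
  apply: (hord_had (n := j) (m := 0) hord_magnus); first exact: hord0n.
  by rewrite addn0.
rewrite hder_had derivM; apply: majD.
  by apply: h => //; apply: maj_le hf.
by apply: IH; [exact: ltnW|exact: maj_der].
Qed.

Lemma majorized_next N M P : (N < M)%N -> majorized N P ->
  majorized N.+1 (next M P).
Proof.
move=> NM hP; split.
- apply: maj_rec => [|t]; first by rewrite integ0 hord_magnus //; apply: lcost0.
  by rewrite deriv_integ; apply: maj_hder_magnus.
- apply: opmaj_had_step => // [|t]; first exact: integ0.
  by rewrite deriv_integ; apply: opmaj_had_diff.
- apply: opmaj_had_step => // [|t]; first exact: integ0.
  by rewrite deriv_integ; apply: opmaj_had_diff.
Qed.

Lemma majorized_iter N M : (N <= M)%N ->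
  majorized N (iter N (next M) (0, 0, 0)).
Proof.
elim: N => [|N IH] NM; first exact: majorized0.
by apply: majorized_next => //; apply: IH; exact: ltnW.
Qed.

End Recursion.

(** * Numerical bound for the majorants *)

Section Trapezoid.
Variable R : realFieldType.
Implicit Types (p : {poly R}) (a b : R).

(** The trapezoidal rule overestimates the integral of n x^(n-1), which is convex for x >= 0. *)
Lemma trapezoid_exp a b n : 0 <= a -> a <= b ->
  2 * (b ^+ n - a ^+ n) <= (b - a) * (n%:R * (a ^+ n.-1 + b ^+ n.-1)).
Proof.
move=> a0 ab; case: n => [|n]; first by rewrite subrr mulr0 !mul0r mulr0.
elim: n => [|n IH]; first by rewrite /= !expr0 !expr1; lra.
rewrite /= in IH *.
(* The induction hypothesis is multiplied by a + b, where (a + b)(a^n + b^n) = 2 (a^(n+1) + b^(n+1))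
   - (b - a)(b^n - a^n); this sign controls the last term. *)
have h0 : 0 <= (b - a) * ((b - a) * (b ^+ n - a ^+ n)).
  by rewrite !mulr_ge0 ?subr_ge0 // lerXn2r // nnegrE (le_trans a0).
have n0 : 0 <= n.+1%:R :> R by [].
have b0 : 0 <= b + a by lra.
move: (ler_wpM2l b0 IH) (mulr_ge0 n0 h0).
rewrite !(exprS _ n.+1) !(exprS _ n) -[n.+2]addn1 natrD.
move: (a ^+ n) (b ^+ n) (n.+1%:R : R) => u v m; clear; nra.
Qed.

Definition nneg_poly p := forall i, 0 <= p`_i.

Lemma nneg_poly0 : nneg_poly 0. Proof. by move=> i; rewrite coef0. Qed.

Lemma nneg_poly1 : nneg_poly 1.
Proof. by move=> i; rewrite coef1 ler0n. Qed.

Lemma nneg_polyD p q : nneg_poly p -> nneg_poly q -> nneg_poly (p + q).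
Proof. by move=> hp hq i; rewrite coefD addr_ge0. Qed.

Lemma nneg_polyM p q : nneg_poly p -> nneg_poly q -> nneg_poly (p * q).
Proof.
by move=> hp hq i; rewrite coefM; apply: sumr_ge0 => j _; rewrite mulr_ge0.
Qed.

Lemma nneg_polyX p n : nneg_poly p -> nneg_poly (p ^+ n).
Proof.
move=> hp; elim: n => [|n IH]; first exact: nneg_poly1.
by rewrite exprS; apply: nneg_polyM.
Qed.

Lemma nneg_polyZ a p : 0 <= a -> nneg_poly p -> nneg_poly (a *: p).
Proof. by move=> a0 hp i; rewrite coefZ mulr_ge0. Qed.

Lemma nneg_poly_sum n (F : 'I_n -> {poly R}) :
  (forall i, nneg_poly (F i)) -> nneg_poly (\sum_(i < n) F i).
Proof. by move=> h i; rewrite coef_sum; apply: sumr_ge0 => j _; apply: h. Qed.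

Lemma trapezoid_poly p a b : nneg_poly p -> 0 <= a -> a <= b ->
  p.[b] <= p.[a] + (b - a) / 2 * (p^`().[a] + p^`().[b]).
Proof.
move=> p0 a0 ab.
have -> : p^`() = \sum_(i < size p) p`_i *: ('X^(i.-1) *+ i).
  by rewrite -[in LHS](coefK p) poly_def raddf_sum; apply: eq_bigr => i _;
     rewrite /= derivZ derivXn.
rewrite -lerBlDl (horner_coef p a) (horner_coef p b) !horner_sum -sumrB -big_split mulr_sumr.
apply: ler_sum => i _ /=; rewrite !hornerZ !hornerMn !hornerXn -mulrBr -mulrDr.
rewrite mulrCA; apply: ler_wpM2l => //.
have := trapezoid_exp i a0 ab.
rewrite -mulrnDl.
by move=> h; lra.
Qed.

Lemma horner_nneg p a : nneg_poly p -> 0 <= a -> 0 <= p.[a].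
Proof.
move=> p0 a0; rewrite horner_coef; apply: sumr_ge0 => i _.
by rewrite mulr_ge0 ?exprn_ge0.
Qed.

End Trapezoid.

Section Numeric.
Variable R : realType.
Local Notation bern := (bern R).
Local Notation rho := (rho R).
Local Notation state := (state R).

Lemma sum_by4 (V : nmodType) (F : nat -> V) n :
  \sum_(i < 4 * n) F i = \sum_(j < n)
    (F (4 * j)%N + F (4 * j).+1 + F (4 * j).+2 + F (4 * j).+3).
Proof.
elim: n => [|n IH]; first by rewrite !big_ord0.
rewrite mulnS addnC addn4 big_ord_recr big_ord_recr big_ord_recr big_ord_recr /=.
by rewrite IH [in RHS]big_ord_recr /= !addrA.
Qed.

(** Any upper bound w for 1 / (1 - v) is allowed, so that rounded table entries can be used. *)
Lemma geometric_bound (v w : R) n : 0 <= v -> v < 1 -> 1 <= (1 - v) * w ->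
  \sum_(j < n) v ^+ j <= w.
Proof.
move=> v0 v1 h; have v1' : 0 < 1 - v by lra.
rewrite -(ler_pM2l v1'); apply: le_trans h.
rewrite -[1 - v]opprB mulNr -subrX1 opprB gerBl exprn_ge0 //.
Qed.

(* Values of [had_maj P n] at a point where the three components of P take the
   values y1, y3, y4. *)
Definition had_val (y1 y3 y4 : R) n : R :=
  y4 ^+ (n %/ 4) * nth 0 [:: 1; y1; y1 ^+ 2; y3] (n %% 4).

Lemma horner_had_maj (P : state) n x :
  (had_maj P n).[x] = had_val P.1.1.[x] P.1.2.[x] P.2.[x] n.
Proof.
rewrite /had_maj /had_val hornerM horner_exp; congr (_ * _).
by case: (n %% 4)%N => [|[|[|[|k]]]] /=;
  rewrite ?hornerC ?horner_exp // !nth_nil horner0.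
Qed.

Lemma had_val4 y1 y3 y4 j r : (r < 4)%N ->
  had_val y1 y3 y4 (4 * j + r) = y4 ^+ j * nth 0 [:: 1; y1; y1 ^+ 2; y3] r.
Proof.
move=> r4; rewrite /had_val mulnC divnMDl // divn_small // addn0.
by rewrite modnMDl modn_small.
Qed.

Lemma bern_4j j : `|bern (4 * j.+1)| <= 2 * (rho ^+ 2) ^+ j.+1.
Proof.
have -> : (4 * j.+1 = (2 * j.+1).*2)%N by lia.
by rewrite -exprM; apply: bern_even_bound; lia.
Qed.

Lemma bern_4j2 j : `|bern (4 * j.+1).+2| <= 2 * rho * (rho ^+ 2) ^+ j.+1.
Proof.
have -> : ((4 * j.+1).+2 = (2 * j.+1).+1.*2)%N by lia.
by rewrite -exprM -mulrA -exprS; apply: bern_even_bound; lia.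
Qed.

Lemma bern_4j1 j : bern (4 * j.+1).+1 = 0.
Proof. have -> : ((4 * j.+1).+1 = (2 * j).+1.*2.+3)%N by lia. exact: bern_odd. Qed.

Lemma bern_4j3 j : bern (4 * j).+3 = 0.
Proof. have -> : ((4 * j).+3 = (2 * j).*2.+3)%N by lia. exact: bern_odd. Qed.

Section Bounds.
Variables (y1 y3 y4 w : R) (Q : nat).
Hypotheses (y1_ge0 : 0 <= y1) (y3_ge0 : 0 <= y3) (y4_ge0 : 0 <= y4).
Let v := rho ^+ 2 * y4.
Hypotheses (v_lt1 : v < 1) (w_inv : 1 <= (1 - v) * w).
Local Notation hv := (had_val y1 y3 y4).

Let rho_gt0 : 0 < rho. Proof. by rewrite /rho; lra. Qed.
Let rho_ge0 : 0 <= rho. Proof. exact: ltW. Qed.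
Let v_ge0 : 0 <= v. Proof. by rewrite mulr_ge0 ?exprn_ge0 // ltW. Qed.

(** The indices 0, 1, 2 are evaluated exactly. Each later block of four has only its two even
    indices, of sizes at most 2 v^j and 2 rho y1^2 v^j, and the sum of v^j over j >= 1 is at most v
    w. *)
Lemma sum_bern_val : \sum_(n < 4 * Q.+1) `|bern n| * hv n <=
  1 + y1 / 2 + y1 ^+ 2 / 12 + (2 + 2 * rho * y1 ^+ 2) * (v * w).
Proof.
rewrite (sum_by4 (fun n => `|bern n| * hv n)) big_ord_recl /=.
have hr j r : (r < 4)%N -> hv (4 * j + r)%N = _ := had_val4 y1 y3 y4 j (r := r).
apply: lerD.
  rewrite muln0 bern0 bern1 bern2 (bern_4j3 0) normr1 normr0 mul0r addr0 mul1r.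
  rewrite !ger0_norm; [|lra..].
  rewrite (hr 0%N 0%N) // (hr 0%N 1%N) // (hr 0%N 2%N) // !expr0 !mul1r /=.
  lra.
apply: (@le_trans _ _ (\sum_(j < Q) (2 + 2 * rho * y1 ^+ 2) * v ^+ j.+1)).
  apply: ler_sum => j _; rewrite -[bump 0 j]/j.+1 bern_4j1 bern_4j3 normr0 !mul0r !addr0.
  rewrite -[X in hv X]addn0 -[X in hv X.+2]addn0 -!addnS !hr //= mulr1.
  rewrite /v [(rho ^+ 2 * y4) ^+ _]exprMn [X in _ <= X]mulrDl.
  have y4j : 0 <= y4 ^+ j.+1 by rewrite exprn_ge0.
  apply: lerD.
    by rewrite mulrA; apply: ler_wpM2r => //; apply: bern_4j.
  rewrite [X in _ <= X](_ : _ = 2 * rho * (rho ^+ 2) ^+ j.+1 * (y4 ^+ j.+1 * y1 ^+ 2)).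
    by apply: ler_wpM2r; [rewrite mulr_ge0 ?exprn_ge0|apply: bern_4j2].
  by ring.
rewrite -mulr_sumr; apply: ler_wpM2l.
  by have := mulr_ge0 rho_ge0 (exprn_ge0 2 y1_ge0); lra.
under eq_bigr => j _ do rewrite exprS.
by rewrite -mulr_sumr; apply: ler_wpM2l => //; apply: geometric_bound.
Qed.

Lemma sum_bernS_val : \sum_(n < (4 * Q.+1).-1) `|bern n.+1| * hv n <=
  1 / 2 + y1 / 12 + (2 * rho * (v * y1) + 2 * rho ^+ 2 * y3) * w.
Proof.
have hv0 n : 0 <= hv n.
  rewrite mulr_ge0 ?exprn_ge0 //.
  by case: (n %% 4)%N => [|[|[|[|k]]]] //=; rewrite ?exprn_ge0 ?nth_nil.
have hr j r : (r < 4)%N -> hv (4 * j + r)%N = _ := had_val4 y1 y3 y4 j (r := r).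
(* The last block lacks one term; adding it, as it is nonnegative, lets the sum be grouped by
   four. *)
apply: (@le_trans _ _ (\sum_(n < 4 * Q.+1) `|bern n.+1| * hv n)).
  case: (4 * Q.+1)%N => [|m]; first by rewrite !big_ord0.
  by rewrite big_ord_recr /= lerDl mulr_ge0.
rewrite (sum_by4 (fun n => `|bern n.+1| * hv n)).
have h4 j : `|bern (4 * j).+4| * hv (4 * j).+3 <= 2 * rho ^+ 2 * y3 * v ^+ j.
  have -> : (4 * j).+4 = (4 * j.+1)%N by lia.
  have -> : (4 * j).+3 = (4 * j + 3)%N by lia.
  rewrite hr // -[nth _ _ _]/y3.
  rewrite [X in _ <= X](_ : _ = 2 * (rho ^+ 2) ^+ j.+1 * (y4 ^+ j * y3)).
    by apply: ler_wpM2r; [rewrite mulr_ge0 ?exprn_ge0|apply: bern_4j].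
  by rewrite /v [(rho ^+ 2 * y4) ^+ _]exprMn (exprS _ j);
    move: ((rho ^+ 2) ^+ j) (y4 ^+ j) => a b; ring.
rewrite big_split /= [X in _ <= X](_ : _ =
  (1 / 2 + y1 / 12 + 2 * rho * y1 * (v * w)) + 2 * rho ^+ 2 * y3 * w); last by ring.
apply: lerD; last first.
  apply: (@le_trans _ _ (\sum_(j < Q.+1) 2 * rho ^+ 2 * y3 * v ^+ j)).
    by apply: ler_sum => j _; apply: h4.
  rewrite -mulr_sumr; apply: ler_wpM2l; last exact: geometric_bound.
  by apply: mulr_ge0 => //; apply: mulr_ge0 => //; exact: exprn_ge0.
rewrite big_ord_recl; apply: lerD.
  rewrite muln0 bern1 bern2 (bern_4j3 0) normr0 mul0r addr0.
  rewrite !ger0_norm; [|lra..].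
  by rewrite (hr 0%N 0%N) // (hr 0%N 1%N) // !expr0 !mul1r /=; lra.
apply: (@le_trans _ _ (\sum_(j < Q) 2 * rho * y1 * v ^+ j.+1)).
  apply: ler_sum => j _; rewrite lift0 bern_4j1 bern_4j3 normr0 !mul0r !addr0 add0r.
  rewrite -[X in hv X.+1]addn0 -!addnS hr //=.
  rewrite [X in _ <= X](_ : _ = 2 * rho * (rho ^+ 2) ^+ j.+1 * (y4 ^+ j.+1 * y1)).
    by apply: ler_wpM2r; [rewrite mulr_ge0 ?exprn_ge0|apply: bern_4j2].
  by rewrite /v [(rho ^+ 2 * y4) ^+ _]exprMn; ring.
rewrite -mulr_sumr; apply: ler_wpM2l; first by apply: mulr_ge0 => //; exact: mulr_ge0.
under eq_bigr => j _ do rewrite exprS.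
by rewrite -mulr_sumr; apply: ler_wpM2l => //; apply: geometric_bound.
Qed.

End Bounds.

(* A grid point x, bounds y1, y3, y4 for the three majorants at x, an upper
   bound w for (1 - rho ^ 2 y4)^-1 and bounds d1, d3, d4 for the three
   derivatives. *)
Record row := Row { rx : R; r1 : R; r3 : R; r4 : R; rw : R;
                    d1 : R; d3 : R; d4 : R }.

(** Twice the bound of [sum_bernS_val]: the factor that multiplies the majorant of ad(Z)^j in its
    own derivative, the same for j = 3 and j = 4. *)
Definition rate (r : row) : R :=
  1 + r1 r / 6 + 4 * rho * (rho * r3 r + rho ^+ 2 * r4 r * r1 r) * rw r.

Definition row_ok (r : row) :=
  [/\ rho ^+ 2 * r4 r < 1, 1 <= (1 - rho ^+ 2 * r4 r) * rw r,
      1 + r1 r / 2 + r1 r ^+ 2 / 12 +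
        (2 + 2 * rho * r1 r ^+ 2) * (rho ^+ 2 * r4 r * rw r) <= d1 r,
      3 * r1 r ^+ 2 + r3 r * rate r <= d3 r &
      2 * r3 r + 2 * r1 r ^+ 3 + r4 r * rate r <= d4 r].

Definition step_ok (r s : row) :=
  [/\ rx r <= rx s,
      r1 r + (rx s - rx r) / 2 * (d1 r + d1 s) <= r1 s,
      r3 r + (rx s - rx r) / 2 * (d3 r + d3 s) <= r3 s &
      r4 r + (rx s - rx r) / 2 * (d4 r + d4 s) <= r4 s].

Fixpoint chain (r : row) (rs : seq row) : Prop :=
  row_ok r /\ (if rs is s :: rs' then step_ok r s /\ chain s rs' else True).

Definition below (P : state) (r : row) :=
  [/\ P.1.1.[rx r] <= r1 r, P.1.2.[rx r] <= r3 r & P.2.[rx r] <= r4 r].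

Fixpoint all_below (P : state) (r : row) (rs : seq row) : Prop :=
  below P r /\ (if rs is s :: rs' then all_below P s rs' else True).

Definition nneg (P : state) :=
  [/\ nneg_poly P.1.1, nneg_poly P.1.2 & nneg_poly P.2].

Lemma nneg0 : nneg (0, 0, 0).
Proof. by split; apply: nneg_poly0. Qed.

Lemma nneg_had_maj P n : nneg P -> nneg_poly (had_maj P n).
Proof.
move=> [n1 n3 n4]; apply: nneg_polyM; first exact: nneg_polyX.
case: (n %% 4)%N => [|[|[|[|k]]]] //=; [exact: nneg_poly1|exact: nneg_polyX|].
by rewrite nth_nil; exact: nneg_poly0.
Qed.

Lemma nneg_bern_sum P n (F : nat -> nat) : nneg P ->
  nneg_poly (\sum_(i < n) `|bern (F i)| *: had_maj P i).
Proof.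
move=> hP; apply: nneg_poly_sum => i; apply: nneg_polyZ => //.
exact: nneg_had_maj.
Qed.

Lemma nneg_rhs M j P : nneg P -> nneg_poly (rhs M j P).
Proof.
move=> hP; apply: nneg_polyD.
  by apply: nneg_poly_sum => i; apply: nneg_polyM; apply: nneg_had_maj.
apply: nneg_polyM; first exact: nneg_had_maj.
by apply: nneg_polyZ => //; apply: (nneg_bern_sum _ S).
Qed.

Lemma nneg_integ (p : {poly R}) :
  nneg_poly p -> nneg_poly (integ p).
Proof.
move=> h i; rewrite coef_poly; case: ifP => // _.
by rewrite divr_ge0.
Qed.

Lemma nneg_next M P : nneg P -> nneg (next M P).
Proof.
by move=> hP; split; apply: nneg_integ;
  [apply: (nneg_bern_sum _ id)|apply: nneg_rhs|apply: nneg_rhs].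
Qed.

(** The right-hand sides increase with y1, y3 and y4, so the tabulated bounds may replace the values
    of the polynomials. *)
Lemma derivative_below Q P r : nneg P -> 0 <= rx r -> row_ok r -> below P r ->
  [/\ (rhs1 (4 * Q.+1) P).[rx r] <= d1 r,
      (rhs (4 * Q.+1) 3 P).[rx r] <= d3 r &
      (rhs (4 * Q.+1) 4 P).[rx r] <= d4 r].
Proof.
move=> [n1 n3 n4] x0 [V1 W1 G1 G3 G4] [b1 b3 b4].
set x := rx r in x0 *; set w := rw r in W1.
have y1_ge0 : 0 <= P.1.1.[x] by apply: horner_nneg.
have y3_ge0 : 0 <= P.1.2.[x] by apply: horner_nneg.
have y4_ge0 : 0 <= P.2.[x] by apply: horner_nneg.
have rho0 : 0 <= rho by rewrite /rho; lra.
have rho20 : 0 <= rho ^+ 2 by apply: exprn_ge0.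
have w0 : 0 <= w.
  by rewrite -(pmulr_rge0 (x := 1 - rho ^+ 2 * r4 r)) ?subr_gt0 // (le_trans ler01).
have vV : rho ^+ 2 * P.2.[x] <= rho ^+ 2 * r4 r by apply: ler_wpM2l.
have v0 : 0 <= rho ^+ 2 * P.2.[x] by apply: mulr_ge0.
have v1 : rho ^+ 2 * P.2.[x] < 1 by apply: le_lt_trans V1.
have w1 : 1 <= (1 - rho ^+ 2 * P.2.[x]) * w.
  by apply: le_trans W1 _; apply: ler_wpM2r => //; lra.
have vw : rho ^+ 2 * P.2.[x] * w <= rho ^+ 2 * r4 r * w by apply: ler_wpM2r.
have vw0 : 0 <= rho ^+ 2 * P.2.[x] * w by apply: mulr_ge0.
have sq : P.1.1.[x] ^+ 2 <= r1 r ^+ 2.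
  by apply: lerXn2r; rewrite ?nnegrE // (le_trans y1_ge0).
have cu : P.1.1.[x] ^+ 3 <= r1 r ^+ 3.
  by apply: lerXn2r; rewrite ?nnegrE // (le_trans y1_ge0).
have sq0 : 0 <= P.1.1.[x] ^+ 2 by apply: exprn_ge0.
have S1 : (rhs1 (4 * Q.+1) P).[x] <= 1 + r1 r / 2 + r1 r ^+ 2 / 12 +
        (2 + 2 * rho * r1 r ^+ 2) * (rho ^+ 2 * r4 r * w).
  rewrite /rhs1 horner_sum; under eq_bigr => i _ do rewrite hornerZ horner_had_maj.
  apply: le_trans (sum_bern_val _ Q y1_ge0 y4_ge0 v1 w1) _.
  apply: lerD; first by lra.
  have rsq : rho * P.1.1.[x] ^+ 2 <= rho * r1 r ^+ 2 by apply: ler_wpM2l.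
  have rsq0 : 0 <= rho * P.1.1.[x] ^+ 2 by apply: mulr_ge0.
  by apply: ler_pM => //; rewrite -!mulrA; lra.
have rate0 M : 0 <= (2 *: \sum_(n < M.-1) `|bern n.+1| *: had_maj P n).[x].
  apply: horner_nneg => //; apply: nneg_polyZ => //.
  by apply: (nneg_bern_sum _ S).
have S2 : (2 *: \sum_(n < (4 * Q.+1).-1) `|bern n.+1| *: had_maj P n).[x]
          <= rate r.
  rewrite hornerZ horner_sum.
  under eq_bigr => i _ do rewrite hornerZ horner_had_maj.
  have := sum_bernS_val Q y1_ge0 y3_ge0 y4_ge0 v1 w1.
  set s := \sum_(i < _) _ => hs.
  have h1 : rho * (rho * P.1.2.[x] + rho ^+ 2 * P.2.[x] * P.1.1.[x]) * w <=
            rho * (rho * r3 r + rho ^+ 2 * r4 r * r1 r) * w.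
    apply: ler_wpM2r => //; apply: ler_wpM2l => //; apply: lerD.
      exact: ler_wpM2l.
    exact: ler_pM.
  rewrite /rate -/w; move: hs h1 b1; clear; rewrite expr2; nra.
have hv0 : (had_maj P 0).[x] = 1.
  by rewrite horner_had_maj /had_val !mul1r.
have hv1 : (had_maj P 1).[x] = P.1.1.[x].
  by rewrite horner_had_maj /had_val !mul1r.
have hv2 : (had_maj P 2).[x] = P.1.1.[x] ^+ 2.
  by rewrite horner_had_maj /had_val !mul1r.
have hv3 : (had_maj P 3).[x] = P.1.2.[x].
  by rewrite horner_had_maj /had_val !mul1r.
have hv4 : (had_maj P 4).[x] = P.2.[x].
  by rewrite horner_had_maj /had_val !mulr1.
split; first exact: le_trans S1 G1.
- apply: le_trans G3; rewrite /rhs hornerD hornerM hv3; apply: lerD.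
    rewrite (_ : (\sum_(i < 3) _).[x] =
      (had_maj P 0).[x] * (had_maj P 2).[x] +
      ((had_maj P 1).[x] * (had_maj P 1).[x] +
       (had_maj P 2).[x] * (had_maj P 0).[x])); last first.
      by rewrite !big_ord_recl big_ord0 addr0 !hornerD !hornerM.
    rewrite hv0 hv1 hv2.
    by move: sq; clear; rewrite !expr2; lra.
  by apply: ler_pM.
- apply: le_trans G4; rewrite /rhs hornerD hornerM hv4; apply: lerD.
    rewrite (_ : (\sum_(i < 4) _).[x] =
      (had_maj P 0).[x] * (had_maj P 3).[x] +
      ((had_maj P 1).[x] * (had_maj P 2).[x] +
       ((had_maj P 2).[x] * (had_maj P 1).[x] +
        (had_maj P 3).[x] * (had_maj P 0).[x]))); last first.
      by rewrite !big_ord_recl big_ord0 addr0 !hornerD !hornerM.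
    rewrite hv0 hv1 hv2 hv3.
    by move: cu b3; clear; rewrite !exprS expr0; lra.
  by apply: ler_pM.
Qed.

(** The induction runs along the grid: the value at the left end concerns the new iterate, while the
    derivatives at both ends are bounded through the old one. *)
Lemma all_below_next Q P r rs : nneg P -> chain r rs -> 0 <= rx r ->
  all_below P r rs -> below (next (4 * Q.+1) P) r ->
  all_below (next (4 * Q.+1) P) r rs.
Proof.
move=> hP; elim: rs r => [|s rs IH] r /=; first by [].
case=> hr [hs hc] x0 [br bs] nr; split => //.
have x0s : 0 <= rx s by case: hs => + _ _ _; apply: le_trans.
have okS : row_ok s by case: (rs) hc => [|t l] [].
have bS : below P s by case: (rs) bs => [|t l] [].
apply: IH => //.
have [u1 u3 u4] := derivative_below Q hP x0 hr br.
have [w1 w3 w4] := derivative_below Q hP x0s okS bS.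
have [m1 m3 m4] := nneg_next (4 * Q.+1) hP.
case: hs => xx g1 g3 g4; case: nr => k1 k3 k4.
have xx0 : 0 <= (rx s - rx r) / 2 by rewrite divr_ge0 // subr_ge0.
have key (p : {poly R}) a a' c c' : nneg_poly p -> p.[rx r] <= a ->
    p^`().[rx r] <= c -> p^`().[rx s] <= c' ->
    a + (rx s - rx r) / 2 * (c + c') <= a' -> p.[rx s] <= a'.
  move=> np pa pc pc' ha; apply: le_trans (trapezoid_poly np x0 xx) _.
  apply: le_trans ha; apply: lerD => //; apply: ler_wpM2l => //; exact: lerD.
by split; [apply: (key _ _ _ _ _ m1 k1 _ _ g1)|apply: (key _ _ _ _ _ m3 k3 _ _ g3)
  |apply: (key _ _ _ _ _ m4 k4 _ _ g4)]; rewrite /= deriv_integ.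
Qed.

Lemma below_last P r rs : all_below P r rs -> below P (last r rs).
Proof. by elim: rs r => [|s rs IH] r [] //= _ /IH. Qed.

Lemma below_iter N Q r rs : chain r rs -> rx r = 0 -> 0 <= r1 r -> 0 <= r3 r ->
  0 <= r4 r -> all (fun s => [&& 0 <= r1 s, 0 <= r3 s & 0 <= r4 s]) rs ->
  all_below (iter N (next (4 * Q.+1)) (0, 0, 0)) r rs.
Proof.
move=> hc x0 a1 a3 a4 hs; set it := iter N _ _.
suff [] : nneg it /\ all_below it r rs by [].
rewrite /it; elim: N {it} => [|N [nN IH]].
  split; first exact: nneg0.
  clear hc x0; elim: rs r a1 a3 a4 hs => [|s rs IH] r a1 a3 a4.
    by move=> _; split => //; split; rewrite horner0.
  move=> /andP[/and3P[c1 c3 c4] hs]; split; last exact: IH.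
  by split; rewrite horner0.
rewrite iterS; split; first exact: nneg_next.
apply: all_below_next => //; first by rewrite x0.
by split; rewrite x0 /= horner_coef0 integ0.
Qed.

(* The same data in thousandths, as binary integers, so that the numerical
   conditions are checked by computation. *)
Record nrow := NRow { nx : N; n1 : N; n3 : N; n4 : N; nw : N;
                      m1 : N; m3 : N; m4 : N }.

Definition natN (n : N) : R := (nat_of_bin n)%:R.

Definition dec (n : N) : R := natN n / 1000.

Lemma dec_ge0 n : 0 <= dec n. Proof. by rewrite divr_ge0 ?ler0n. Qed.

Definition row_of (r : nrow) : row :=
  Row (dec (nx r)) (dec (n1 r)) (dec (n3 r)) (dec (n4 r)) (dec (nw r))
      (dec (m1 r)) (dec (m3 r)) (dec (m4 r)).

(* The conditions of [row_ok] and [step_ok], cleared of denominators. *)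
Definition nrate (r : nrow) : N :=
  let k := 1000%num in let e := 379%num in
  (6 * (e * e * e) * (k * k * k) + e * e * e * k * k * n1 r +
   240 * nw r * (10 * e * k * n3 r + 100 * n4 r * n1 r))%num.

Definition nrow_check (r : nrow) : bool :=
  let k := 1000%num in let e := 379%num in
  [&& N.leb (100 * n4 r + 1) (e * e * k),
      N.leb (e * e * k * k + 100 * n4 r * nw r) (e * e * k * nw r),
      N.leb (12 * (e * e * e) * (k * k * k * k) +
             6 * (e * e * e) * (k * k * k) * n1 r +
             e * e * e * k * k * n1 r * n1 r +
             12 * (2 * e * k * k + 20 * n1 r * n1 r) * 100 * n4 r * nw r)
            (12 * (e * e * e) * (k * k * k) * m1 r),
      N.leb (18 * (e * e * e) * (k * k) * n1 r * n1 r + n3 r * nrate r)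
            (6 * (e * e * e) * (k * k * k) * m3 r) &
      N.leb (12 * (e * e * e) * (k * k * k) * n3 r +
             12 * (e * e * e) * k * n1 r * n1 r * n1 r + n4 r * nrate r)
            (6 * (e * e * e) * (k * k * k) * m4 r)]%num.

Definition nstep_check (r s : nrow) : bool :=
  let k2 := (2 * 1000)%num in
  [&& N.leb (nx r) (nx s),
      N.leb (k2 * n1 r + nx s * (m1 r + m1 s)) (k2 * n1 s + nx r * (m1 r + m1 s)),
      N.leb (k2 * n3 r + nx s * (m3 r + m3 s)) (k2 * n3 s + nx r * (m3 r + m3 s)) &
      N.leb (k2 * n4 r + nx s * (m4 r + m4 s)) (k2 * n4 s + nx r * (m4 r + m4 s))]%num.

Fixpoint nchain_check (r : nrow) (rs : seq nrow) : bool :=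
  nrow_check r && (if rs is s :: rs' then nstep_check r s && nchain_check s rs'
                   else true).

Lemma lebN_real (a b : N) : N.leb a b -> natN a <= natN b.
Proof. by move=> h; rewrite ler_nat; lia. Qed.

Lemma natN_add (a b : N) : natN (a + b)%num = natN a + natN b.
Proof. by rewrite -natrD; congr (_%:R); lia. Qed.

Lemma natN_mul (a b : N) : natN (a * b)%num = natN a * natN b.
Proof. by rewrite -natrM; congr (_%:R); lia. Qed.

Lemma natN_small :
  ((natN 1 = 1) * (natN 2 = 2) * (natN 6 = 6) * (natN 10 = 10) *
   (natN 12 = 12) * (natN 18 = 18) * (natN 20 = 20) * (natN 100 = 100) *
   (natN 240 = 240) * (natN 379 = 379) * (natN 1000 = 1000))%type.
Proof. by []. Qed.

Opaque natN.

Lemma nrow_checkP r : nrow_check r -> row_ok (row_of r).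
Proof.
case: r => x a c d w e1 e3 e4 /and5P[]; rewrite /nrate /n1 /n3 /n4 /nw /m1 /m3 /m4.
move=> /lebN_real h1 /lebN_real h2 /lebN_real h3 /lebN_real h4 /lebN_real h5.
rewrite !(natN_add, natN_mul) !natN_small in h1 h2 h3 h4 h5.
rewrite /row_ok /row_of /rate /r1 /r3 /r4 /rw /d1 /d3 /d4 /dec /rho.
move: (natN a) (natN c) (natN d) (natN w) (natN e1) (natN e3) (natN e4)
  h1 h2 h3 h4 h5 => {}a {}c {}d {}w {}e1 {}e3 {}e4 h1 h2 h3 h4 h5.
by split; [move: h1|move: h2|move: h3|move: h4|move: h5]; clear; lra.
Qed.

Lemma nstep_checkP r s : nstep_check r s -> step_ok (row_of r) (row_of s).
Proof.
case: r => x a c d w e1 e3 e4; case: s => x' a' c' d' w' e1' e3' e4' /and4P[].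
rewrite /nx /n1 /n3 /n4 /m1 /m3 /m4.
move=> /lebN_real h1 /lebN_real h2 /lebN_real h3 /lebN_real h4.
rewrite !(natN_add, natN_mul) !natN_small in h1 h2 h3 h4.
rewrite /step_ok /row_of /rx /r1 /r3 /r4 /d1 /d3 /d4 /dec.
by split; [move: h1|move: h2|move: h3|move: h4]; clear; lra.
Qed.

Lemma nchain_checkP r rs :
  nchain_check r rs -> chain (row_of r) [seq row_of s | s <- rs].
Proof.
elim: rs r => [|s rs IH] r; first by rewrite /= andbT => /nrow_checkP.
by case/andP => /nrow_checkP hr /andP[/nstep_checkP hs /IH hc].
Qed.

Definition nrow0 : nrow :=
  NRow 0 0 0 0 1000 1000 0 0.

(** The steps shrink from 0.188 to 0.024 as the ratio rho^2 r4 grows; in the last row it is about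
    0.82, and the geometric factor 5.447. *)
Definition nrows : seq nrow :=
  [:: NRow 188 198 13 5 1001 1103 132 47;
      NRow 367 406 77 39 1001 1217 577 330;
      NRow 537 624 249 167 1001 1345 1444 1169;
      NRow 699 854 599 507 1001 1489 2874 3024;
      NRow 852 1095 1204 1236 1001 1650 5025 6500;
      NRow 997 1348 2156 2608 1002 1830 8106 12422;
      NRow 1133 1611 3546 4933 1004 2030 12322 21764;
      NRow 1261 1886 5485 8621 1007 2253 17972 35861;
      NRow 1381 2172 8086 14151 1010 2502 25369 56293;
      NRow 1493 2468 11460 22060 1016 2778 34866 84925;
      NRow 1598 2776 15758 33047 1024 3087 46985 124351;
      NRow 1696 3096 21113 47841 1035 3434 62286 177555;
      NRow 1786 3423 27568 66950 1049 3816 81154 247070;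
      NRow 1871 3766 35480 91881 1069 4253 105010 339538;
      NRow 1949 4117 44816 123001 1094 4743 134360 458397;
      NRow 2021 4479 55801 161512 1127 5299 170756 611353;
      NRow 2087 4850 68558 208305 1170 5936 215812 806590;
      NRow 2147 5229 83183 264139 1226 6670 271678 1054527;
      NRow 2203 5628 100428 332362 1302 7560 344192 1381996;
      NRow 2253 6033 119951 412013 1403 8628 436704 1804023;
      NRow 2298 6452 142383 505904 1544 9978 560267 2368903;
      NRow 2339 6900 169031 619720 1759 11842 739615 3183077;
      NRow 2374 7362 199668 752322 2100 14544 1011034 4394158;
      NRow 2404 7872 237621 917191 2767 19412 1519160 6597090;
      NRow 2428 8555 297611 1172692 5447 37446 3479975 14694633].

Lemma chain_rows : chain (row_of nrow0) [seq row_of s | s <- nrows].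
Proof. by apply: nchain_checkP; vm_compute. Qed.

(** Uniformity in N and Q is what matters; 9 is a round number above the last tabulated value
    8.555. *)
Lemma iter_bounded N Q :
  (iter N (next (4 * Q.+1)) (0, 0, 0) : state).1.1.[2428 / 1000] <= 9.
Proof.
have : all_below (iter N (next (4 * Q.+1)) (0, 0, 0)) (row_of nrow0)
        [seq row_of s | s <- nrows].
  apply: (below_iter N Q chain_rows); rewrite ?dec_ge0 //.
    by rewrite /rx /row_of /dec mul0r.
  by elim: nrows => //= s l ->; rewrite !dec_ge0.
move=> /below_last; rewrite last_map => -[+ _ _].
have -> : last nrow0 nrows = NRow 2428 8555 297611 1172692 5447 37446 3479975 14694633 by [].
rewrite /row_of /rx /r1 => h.
have -> : 2428 / 1000 = dec 2428 by [].
apply: le_trans h _.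
have hN : N.leb 8555 (9 * 1000) by [].
move: (lebN_real hN); rewrite natN_mul natN_small /dec.
have -> : natN 9 = 9 by [].
by clear; move: (natN 8555) => x h; lra.
Qed.

End Numeric.

(** * The Magnus commutator as a value of the logarithm *)

Section Splits.
Implicit Types s u v w : seq nat.

Fixpoint splits s : seq (seq nat * seq nat) :=
  if s is t :: s' then
    [seq (t :: p.1, p.2) | p <- splits s'] ++
    [seq (p.1, t :: p.2) | p <- splits s']
  else [:: ([::], [::])].

Lemma splits_subseq s p : p \in splits s -> subseq p.1 s && subseq p.2 s.
Proof.
elim: s p => [|t s IH] p /=; first by rewrite inE => /eqP ->.
have sub u : subseq u s -> subseq u (t :: s).
  by move=> h; apply: subseq_trans h (subseq_cons _ _).
rewrite mem_cat => /orP[] /mapP[q /IH /andP[h1 h2] -> /=].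
  by rewrite eqxx h1; apply: sub.
by rewrite eqxx h2 andbT; apply: sub.
Qed.

Lemma hserM_splits (A : nzRingType) (f g : hser A) s :
  (f * g) s = \sum_(p <- splits s) f p.1 * g p.2.
Proof.
elim: s f g => [|t s IH] f g; first by rewrite big_seq1.
by rewrite hserM_cons !IH /= big_cat !big_map.
Qed.

Lemma rem_cat (T : eqType) (x : T) (u v : seq T) :
  rem x (u ++ v) = if x \in u then rem x u ++ v else u ++ rem x v.
Proof.
elim: u => //= y u IH; rewrite inE eq_sym; case: eqP => //= _.
by rewrite IH; case: ifP.
Qed.

(** As the letters are distinct, only the splitting by membership in u can match, and it matches
    when u ++ v rearranges s. *)
Lemma sum_splits_perm s u v : uniq s ->
  (\sum_(p <- splits s) (perm_eq u p.1 && perm_eq v p.2) = perm_eq (u ++ v) s)%N.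
Proof.
have cons u' t r : perm_eq u' (t :: r) = (t \in u') && perm_eq (rem t u') r.
  case: (boolP (t \in u')) => /= tu.
    by rewrite (permPl (perm_to_rem tu)) perm_cons.
  by apply: contraNF tu => /perm_mem ->; rewrite mem_head.
have nilE w : perm_eq w [::] = (w == [::]) by apply/perm_nilP/eqP.
elim: s u v => [|t s IH] u v.
  by rewrite big_seq1 !nilE; case: u => [|x u]; case: v.
case/andP=> ts us; rewrite big_cat !big_map /= cons.
have mask (b : bool) (F : seq nat * seq nat -> bool) :
    (\sum_(p <- splits s) (b && F p) = b * \sum_(p <- splits s) F p)%N.
  by case: b; [rewrite mul1n|rewrite mul0n big1].
under eq_bigr => p _ do rewrite cons -andbA.
under [X in (_ + X)%N]eq_bigr => p _ do rewrite cons andbCA.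
rewrite !mask !IH // mem_cat.
have noT w r : t \in w -> perm_eq (w ++ r) s = false.
  move=> tw; apply: contraNF ts => /perm_mem <-.
  by rewrite mem_cat tw.
case: (boolP (t \in u)) => tu /=.
  by rewrite mul1n rem_cat tu [perm_eq (u ++ _) s]noT //= muln0 addn0.
rewrite mul0n add0n; case: (boolP (t \in v)) => tv; rewrite ?mul0n //.
by rewrite mul1n rem_cat (negbTE tu).
Qed.

End Splits.

Section WordSum.
Variable R : realType.
Implicit Types (f g : ncseries R) (s u v w : seq nat).
Local Notation A := (falg R).

(** The multilinear part of a series; on words with distinct letters this map turns the
    concatenation product into the shuffle product. *)
Definition word_sum f : hser A := fun s =>
  \sum_(w <- permutations s) << f w *g FMonom w >> : free_algebra R.

(** Either list contains (u, v) once if u ++ v rearranges s and never otherwise; comparing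
    multiplicities avoids an explicit bijection. *)
Lemma perm_cuts s : uniq s ->
  perm_eq
    [seq (take i w, drop i w) | w <- permutations s, i <- iota 0 (size w).+1]
    (flatten [seq [seq (u, v) | u <- permutations p.1, v <- permutations p.2]
             | p <- splits s]).
Proof.
move=> us; apply/allP => -[u v] _; apply/eqP.
have cuts w : count_mem (u, v) [seq (take i w, drop i w) | i <- iota 0 (size w).+1]
              = (w == u ++ v).
  rewrite count_map; case: eqP => [->|wuv]; last first.
    rewrite (eq_count (a2 := pred0)) ?count_pred0 // => i /=.
    apply/eqP => -[ui vi]; case: wuv; by rewrite -ui -vi cat_take_drop.
  rewrite (eq_in_count (a2 := pred1 (size u))) => [|i].
    by rewrite count_uniq_mem ?iota_uniq // mem_iota leq0n add0n ltnS size_cat leq_addr.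
  rewrite mem_iota ?add0n ltnS => /andP[_ iuv]; apply/eqP/eqP => [[hu _]|/= ->].
    by rewrite -hu size_takel.
  by rewrite take_size_cat // drop_size_cat.
rewrite !count_flatten -!map_comp !sumnE !big_map.
have count1 x y (a b : seq (seq nat)) : uniq a -> uniq b ->
    count_mem (x, y) [seq (i, j) | i <- a, j <- b] = ((x \in a) && (y \in b)) :> nat.
  move=> ua ub; rewrite count_uniq_mem; last first.
    by apply: allpairs_uniq => // -[? ?] [? ?] _ _ [-> ->].
  congr nat_of_bool; apply/allpairsP/andP => [[[a1 b1] /= [h1 h2 [-> ->]]]|[h1 h2]] //.
  by exists (x, y).
transitivity (perm_eq (u ++ v) s : nat); last first.
  rewrite -sum_splits_perm //; apply: eq_bigr => p _ /=.
  by rewrite count1 ?permutations_uniq // !mem_permutations.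
have -> : forall r, (\sum_(w <- r) count_mem (u, v)
    [seq (take i w, drop i w) | i <- iota 0 (size w).+1] =
    count_mem (u ++ v) r)%N.
  move=> r; rewrite -sum1_count [RHS]big_mkcond; apply: eq_bigr => w _.
  by rewrite cuts /=; case: (w == u ++ v).
by rewrite -mem_permutations (count_uniq_mem _ (permutations_uniq s)).
Qed.

Lemma word_sum_mul f g s : uniq s ->
  word_sum (ncs_mul f g) s = (word_sum f * word_sum g) s.
Proof.
move=> us; rewrite hserM_splits.
pose G (q : seq nat * seq nat) : A :=
  << f q.1 * g q.2 *g FMonom (q.1 ++ q.2) >> : free_algebra R.
transitivity (\sum_(q <- flatten [seq [seq (u, v) | u <- permutations p.1,
    v <- permutations p.2] | p <- splits s]) G q).
  rewrite -(perm_big _ (perm_cuts us)) big_allpairs_dep; apply: eq_bigr => w _.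
  rewrite /ncs_mul raddf_sum -(big_mkord xpredT
    (fun i => << f (take i w) * g (drop i w) *g FMonom w >> : A)) /index_iota subn0.
  by apply: eq_bigr => i _; rewrite /G cat_take_drop.
rewrite big_flatten big_map; apply: eq_bigr => p _.
rewrite big_allpairs_dep mulr_suml; apply: eq_bigr => u _.
by rewrite mulr_sumr; apply: eq_bigr => v _; rewrite [RHS]word_cat.
Qed.

Lemma uniq_splits s p : uniq s -> p \in splits s -> uniq p.1 && uniq p.2.
Proof.
by move=> us /splits_subseq /andP[h1 h2]; rewrite !(subseq_uniq _ us).
Qed.

Lemma word_sum_pow f n s : uniq s ->
  word_sum (ncs_pow f n) s = (word_sum f ^+ n) s.
Proof.
elim: n s => [|n IH] s us.
  rewrite /word_sum /ncs_pow [iter 0 _ _]/= /ncs_one expr0; case: s us => [|t s] us.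
    by rewrite /permutations big_seq1 [LHS]word_nil.
  rewrite big_seq big1 // => w; rewrite mem_permutations => /perm_size ws.
  rewrite (_ : (w == [::]) = false) ?monalgU0 //.
  by apply/eqP => w0; rewrite w0 in ws.
rewrite exprS -[ncs_pow f n.+1]/(ncs_mul f (ncs_pow f n)) word_sum_mul //.
rewrite [LHS]hserM_splits [RHS]hserM_splits big_seq [RHS]big_seq.
apply: eq_bigr => p ps; congr (_ * _).
by apply: IH; case/andP: (uniq_splits us ps).
Qed.

Lemma hserX_sorted (B : nzRingType) (a b : hser B) n :
  (forall s, sorted gtn s -> a s = b s) ->
  forall s, sorted gtn s -> (a ^+ n) s = (b ^+ n) s.
Proof.
move=> ab; elim: n => [|n IH] s ss //.
rewrite !exprS !hserM_splits !big_seq; apply: eq_bigr => p ps.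
have tr : transitive gtn by move=> x y z xy yz; apply: ltn_trans yz xy.
by have /andP[h1 h2] := splits_subseq ps; rewrite ab ?IH //; apply: subseq_sorted ss.
Qed.

(** The multilinear part of exp(X_1) exp(X_2) ... - 1: distinct letters are picked in the order of
    the factors. *)
Definition increasing : ncseries R :=
  fun w => ((w != [::]) && sorted ltn w)%:R.

Lemma word_sum_increasing s : sorted gtn s ->
  word_sum increasing s = (exp_prod R - 1) s.
Proof.
move=> ss; rewrite /word_sum /increasing hserB /exp_prod.
case: s ss => [|t s] ss.
  by rewrite /permutations big_seq1 /= monalgU0 [X in _ = X - _]word_nil [RHS]subrr.
rewrite [RHS]subr0.
have us : uniq (t :: s).
  by apply: sorted_uniq ss; [move=> x y z xy yz; apply: ltn_trans yz xy|exact: ltnn].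
rewrite (bigD1_seq (rev (t :: s))) ?permutations_uniq //=; last first.
  by rewrite mem_permutations perm_rev.
rewrite rev_sorted ss -size_eq0 size_rev /= big_seq_cond big1 ?addr0 //.
move=> w /andP[]; rewrite mem_permutations => pw wr.
rewrite (_ : sorted ltn w = false) ?andbF ?monalgU0 //.
apply: contraNF wr => sw; apply/eqP.
apply: (irr_sorted_eq ltn_trans ltnn) => //; first by rewrite rev_sorted.
by move=> x; rewrite mem_rev (perm_mem pw).
Qed.

End WordSum.

Section LogProdExp.
Variable R : realType.
Implicit Types (f g : ncseries R) (v w : seq nat).

Lemma ncs_pow_var m n w : ncs_pow (ncs_var R m) n w = (w == nseq n m)%:R.
Proof.
elim: n w => [|n IH] w //.
rewrite -[ncs_pow _ _ _]/(ncs_mul (ncs_var R m) (ncs_pow (ncs_var R m) n) w).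
rewrite /ncs_mul /ncs_var; case: w => [|x w].
  by rewrite big_ord1 /= mul0r.
rewrite big_ord_recl /= mul0r add0r big_ord_recl /= take0 drop0 IH big1 ?addr0.
  by rewrite !eqseq_cons andbT -natrM mulnb.
move=> i _; rewrite /bump /= add1n eqseq_cons; case: w i => [|y w] i /=.
  by case: i => [[]].
by rewrite andbF mul0r.
Qed.

Lemma ncs_exp_var m w : uniq w ->
  ncs_exp (ncs_var R m) w = ((w == [::]) || (w == [:: m]))%:R.
Proof.
move=> uw; rewrite /ncs_exp /ncs_comp.
have -> : (w == [::]) || (w == [:: m]) = (w == nseq (size w) m).
  case: w uw => [|x [|y w]] //= /andP[].
  rewrite inE negb_or => /andP[xy _] _; rewrite !eqseq_cons andbF.
  apply/esym/negbTE; apply: contra xy => /and3P[/eqP -> /eqP -> _] //.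
rewrite (bigD1 ord_max) //= big1 => [|n nw].
  rewrite addr0 ncs_pow_var; case: eqP => [e|_]; last by rewrite mulr0.
  have : (size w <= 1)%N by move: uw; rewrite e; case: (size w) => [|[|k]] //=; rewrite inE eqxx.
  by case: (size w) => [|[|k]] //; rewrite ?fact0 invr1 mulr1.
rewrite ncs_pow_var; case: eqP => [e|_]; last by rewrite mulr0.
have := congr1 size e; rewrite size_nseq => sz.
by case/eqP: nw; apply: val_inj; exact: esym sz.
Qed.

Definition prod_exp m k : ncseries R :=
  \big[@ncs_mul R/ncs_one R]_(i < k) ncs_exp (ncs_var R (m + i)%N).

(** Only the first factor can supply the letter m, and in a word without repetition it supplies at
    most this one letter, at the front. *)
Lemma prod_expE m k w : uniq w -> prod_exp m k w =
  [&& sorted ltn w, all (leq m) w & all (gtn (m + k)%N) w]%:R.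
Proof.
elim: k m w => [|k IH] m w uw.
  rewrite /prod_exp big_ord0 /ncs_one addn0; congr (_%:R); congr nat_of_bool.
  case: w uw => [|x w] // _; apply/esym/negbTE/negP.
  by case/and3P => _ /andP[mx _] /andP[/= xm _]; rewrite ltnNge mx in xm.
have -> : prod_exp m k.+1 = ncs_mul (ncs_exp (ncs_var R m)) (prod_exp m.+1 k).
  rewrite /prod_exp big_ord_recl /= addn0; congr ncs_mul.
  by apply: eq_bigr => i _; rewrite addnS -addSn.
rewrite /ncs_mul; case: w uw => [|x w] uw.
  by rewrite big_ord1 ncs_exp_var // IH // mul1r.
rewrite big_ord_recl big_ord_recl /= big1 ?addr0 => [|i _]; last first.
  rewrite /bump /= !add1n add0n ncs_exp_var; last exact: (take_uniq i.+2 uw).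
  by case: w uw i => [|y w] uw i; [case: i => [[]]|rewrite !eqseq_cons andbF mul0r].
rewrite add0n take0 drop0 !ncs_exp_var // !IH //; last by case/andP: uw.
rewrite /= eqseq_cons andbT mul1r addSnnS.
set P := all (gtn (m + k.+1)%N) w; rewrite (path_sortedE ltn_trans).
case: (x =P m) => [->|/eqP xm].
  rewrite ltnn /= andbF add0r mul1r leqnn /=; congr (_%:R); congr nat_of_bool.
  have -> : (m < m + k.+1)%N by rewrite -addSnnS leq_addr.
  rewrite /= -/(ltn m); have -> : all (leq m.+1) w = all (ltn m) w by [].
  case: (boolP (all (ltn m) w)) => //= mw; last by rewrite andbF.
  have -> // : all (leq m) w by apply: sub_all mw => y; apply: ltnW.
rewrite mul0r addr0; congr (_%:R); congr nat_of_bool.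
rewrite [in RHS]leq_eqVlt eq_sym (negbTE xm) /=.
case: (boolP (all (ltn x) w)) => //= xw.
case: (ltnP m x) => //= mx.
have -> : all (leq m.+1) w by apply: sub_all xw => y xy; apply: leq_trans mx (ltnW xy).
by have -> : all (leq m) w by apply: sub_all xw => y xy; apply: leq_trans (ltnW mx) (ltnW xy).
Qed.

Lemma ncs_pow_congr (C : seq nat -> Prop) f g n :
  (forall w i, C w -> C (take i w) /\ C (drop i w)) ->
  (forall w, C w -> f w = g w) ->
  forall w, C w -> ncs_pow f n w = ncs_pow g n w.
Proof.
move=> hC fg; elim: n => [|n IH] w Cw //.
rewrite -[ncs_pow f _ _]/(ncs_mul f (ncs_pow f n) w).
rewrite -[ncs_pow g _ _]/(ncs_mul g (ncs_pow g n) w).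
apply: eq_bigr => i _; have [h1 h2] := hC w i Cw.
by rewrite fg // IH.
Qed.

Lemma log_prod_expE k w : perm_eq w (iota 0 k) ->
  log_prod_exp R k w =
  \sum_(n < k.+1) log_coef R n * ncs_pow (increasing R) n w.
Proof.
move=> pw; rewrite /log_prod_exp /ncs_log /ncs_comp (perm_size pw) size_iota.
apply: eq_bigr => n _; congr (_ * _).
pose C v := uniq v && all (gtn k) v.
apply: (@ncs_pow_congr C).
- move=> v i /andP[uv av]; split; apply/andP; split.
  + exact: take_uniq.
  + by apply/allP => x /mem_take; apply: (allP av).
  + exact: drop_uniq.
  + by apply/allP => x /mem_drop; apply: (allP av).
- move=> v /andP[uv av]; rewrite /ncs_sub /ncs_one /increasing.
  rewrite -/(prod_exp 0 k) prod_expE // add0n av andbT (_ : all (leq 0) v) ?andbT; last exact/allP.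
  by case: v uv av => [|x v] uv av; rewrite /= ?subrr ?subr0.
by rewrite /C (perm_uniq pw) iota_uniq; apply/allP => x; rewrite (perm_mem pw) mem_iota.
Qed.

(** On decreasing words [exp_prod - 1] is the word sum of [increasing]; subwords of decreasing words
    are decreasing, so this passes to powers and hence to the logarithm. *)
Lemma magnus_rev_iota k :
  magnus R (rev (iota 0 k)) = magnus_commutator R k.
Proof.
have ss : sorted gtn (rev (iota 0 k)) by rewrite rev_sorted iota_ltn_sorted.
rewrite /magnus /hlog size_rev size_iota.
have us : uniq (rev (iota 0 k)) by rewrite rev_uniq iota_uniq.
have pow_word m : ((exp_prod R - 1) ^+ m) (rev (iota 0 k)) =
    word_sum (ncs_pow (increasing R) m) (rev (iota 0 k)).
  rewrite word_sum_pow //; apply/esym/hserX_sorted => // s.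
  exact: word_sum_increasing.
transitivity (\sum_(m < k.+1) log_coef R m *:
   (word_sum (ncs_pow (increasing R) m) (rev (iota 0 k)))).
  by apply: eq_bigr => m _; congr (_ *: _); rewrite pow_word.
rewrite /magnus_commutator /word_sum.
under eq_bigr => m _ do rewrite scaler_sumr.
rewrite exchange_big /= (perm_big (permutations (iota 0 k))) /=; last first.
  apply: uniq_perm; rewrite ?permutations_uniq // => w.
  by rewrite !mem_permutations; apply: permPr; rewrite perm_rev.
rewrite !big_seq; apply: eq_bigr => w; rewrite mem_permutations => pw.
rewrite log_prod_expE // raddf_sum; apply: eq_bigr => m _ /=.
by rewrite [LHS]malgZU.
Qed.

End LogProdExp.

(** * Lower bound for the norm *)

Section MonomialNorm.
Variable R : realType.
Implicit Types (P M : free_algebra R) (e : seq nat -> R) (k n : nat).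

Definition pairing e k P : R :=
  \sum_(w <- permutations (iota 0 k)) e w * P@_(FMonom w).

Lemma pairing_sum e k I (r : seq I) (F : I -> free_algebra R) :
  pairing e k (\sum_(i <- r) F i) = \sum_(i <- r) pairing e k (F i).
Proof.
rewrite /pairing exchange_big; apply: eq_bigr => w _ /=.
by rewrite raddf_sum mulr_sumr.
Qed.

Lemma pairingZ e k c P : pairing e k (c *: P) = c * pairing e k P.
Proof.
by rewrite /pairing mulr_sumr; apply: eq_bigr => w _; rewrite mcoeffZ mulrCA.
Qed.

Lemma pairing_word e k c v : pairing e k << c *g FMonom v >> =
  if perm_eq v (iota 0 k) then e v * c else 0.
Proof.
have fmE w : (FMonom v == FMonom w) = (v == w) by rewrite fmP.
rewrite /pairing; under eq_bigr => w _ do rewrite mcoeffU fmE.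
case: ifP => pv; last first.
  rewrite big_seq big1 // => w; rewrite mem_permutations => pw.
  by case: eqP => [vw|_]; rewrite ?mulr0n ?mulr0 // vw pw in pv *.
rewrite (bigD1_seq v) ?permutations_uniq ?mem_permutations //= eqxx mulr1n.
by rewrite big1 ?addr0 // => w; rewrite eq_sym => /negbTE ->; rewrite mulr0n mulr0.
Qed.

Lemma lie_monomial_words M : lie_monomial M ->
  exists n (l : seq (bool * seq nat)),
    [/\ size l = (2 ^ n)%N, forall p, p \in l -> size p.2 = n.+1 &
        M = \sum_(p <- l) << (-1) ^+ p.1 *g FMonom p.2 >>].
Proof.
elim=> [i|a b _ [m [l [sl hl ->]]] _ [n [r [sr hr ->]]]|a _ [n [l [sl hl ->]]]].
- exists 0%N, [:: (false, [:: i])]; split=> //; last by rewrite big_seq1 expr0.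
  by move=> p; rewrite inE => /eqP ->.
- exists (m + n).+1, ([seq (p.1 (+) q.1, p.2 ++ q.2) | p <- l, q <- r] ++
      [seq (~~ (p.1 (+) q.1), q.2 ++ p.2) | p <- l, q <- r]); split.
  + by rewrite size_cat !size_allpairs sl sr addnn -mul2n expnS expnD.
  + move=> p; rewrite mem_cat => /orP[] /allpairsP[[p1 p2] [/hl /= h1 /hr /= h2 ->]] /=;
      by rewrite size_cat h1 h2; lia.
  + rewrite big_cat !big_allpairs_dep /lie_bracket mulr_suml [X in _ - X]mulr_sumr.
    rewrite -sumrN; congr (_ + _); apply: eq_bigr => p _ /=.
      by rewrite mulr_sumr; apply: eq_bigr => q _; rewrite word_cat signr_addb.
    rewrite mulr_suml -sumrN; apply: eq_bigr => q _.
    by rewrite word_cat signrN signr_addb mulrC monalgUN.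
- exists n, [seq (~~ p.1, p.2) | p <- l]; split.
  + by rewrite size_map.
  + by move=> p /mapP[q /hl hq ->].
  + by rewrite big_map -sumrN; apply: eq_bigr => p _; rewrite signrN monalgUN.
Qed.

(** Monomials of another degree contain no permutation of the k + 1 letters and pair to 0. *)
Lemma pairing_lie_monomial e k M : (forall w, `|e w| <= 1) -> lie_monomial M ->
  `|pairing e k.+1 M| <= 2 ^+ k.
Proof.
move=> he /lie_monomial_words[n [l [sl hl ->]]]; rewrite pairing_sum.
case: (n =P k) => [nk|nk]; last first.
  rewrite big_seq big1 ?normr0 ?exprn_ge0 // => p /hl sp; rewrite pairing_word.
  by case: ifP => // /perm_size; rewrite sp size_iota => -[].
apply: le_trans (ler_norm_sum _ _ _) _.
rewrite -nk -natrX -sl -sum1_size natr_sum.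
apply: ler_sum => p _; rewrite pairing_word; case: ifP => _; last by rewrite normr0.
by rewrite normrM normr_sign mulr1.
Qed.

Lemma pairing_le_l1norm e k P : (forall w, `|e w| <= 1) ->
  ((`|pairing e k.+1 P| / 2 ^+ k)%:E <= lie_l1norm P)%E.
Proof.
move=> he; apply: le_ereal_inf_tmp => _ [s [ms ->] <-].
rewrite lee_fin ler_pdivrMr ?exprn_gt0 // pairing_sum.
apply: le_trans (ler_norm_sum _ _ _) _; rewrite mulr_suml big_seq [leRHS]big_seq.
apply: ler_sum => p /ms mp; rewrite pairingZ normrM; apply: ler_wpM2l => //.
exact: pairing_lie_monomial.
Qed.

End MonomialNorm.

(** * Coefficients of the Magnus commutator *)

Section Coefficients.
Variable R : realType.

(* For a word with a ascents and d descents: a cut into n increasing blocks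
   consists of all the descents and n - 1 - d of the ascents. *)
Definition ad_coef (a d n : nat) : nat := if (d < n)%N then 'C(a, n - d.+1) else 0%N.

Lemma ad_coef_pascal a d n :
  (ad_coef a.+1 d n = ad_coef a d n + ad_coef a d.+1 n)%N.
Proof.
rewrite /ad_coef; case: (ltngtP d.+1 n) => [dn|dn|<-].
- by rewrite (_ : n - d.+1 = (n - d.+2).+1)%N ?binS //; lia.
- by [].
- by rewrite subnn !bin0.
Qed.

Lemma ad_coefSS a d n : ad_coef a d.+1 n.+1 = ad_coef a d n.
Proof. by rewrite /ad_coef ltnS subSS. Qed.

(** The first block is x alone or, if x < y, the first block of a cut of y :: v with x put in
    front. *)
Lemma ncs_pow_increasing_cons n x y v :
  ncs_pow (increasing R) n.+1 [:: x, y & v] =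
  ncs_pow (increasing R) n (y :: v) +
  (x < y)%N%:R * ncs_pow (increasing R) n.+1 (y :: v).
Proof.
have powS w : ncs_pow (increasing R) n.+1 w =
  ncs_mul (increasing R) (ncs_pow (increasing R) n) w by [].
rewrite !powS /ncs_mul 2!big_ord_recl [in RHS]big_ord_recl /= {1 2 4}/increasing /=.
rewrite !mul0r !add0r mul1r; congr (_ + _); rewrite mulr_sumr.
apply: eq_bigr => i _ /=; rewrite mulrA /increasing /=.
by rewrite -natrM mulnb.
Qed.

Lemma ncs_pow_increasing x v : exists a d, [/\ (a + d = size v)%N &
  forall n, ncs_pow (increasing R) n (x :: v) = (ad_coef a d n)%:R].
Proof.
elim: v x => [|y v IH] x.
  exists 0%N, 0%N; split=> // -[|n]; first by rewrite /ncs_pow /ncs_one.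
  rewrite /ncs_pow iterS /ncs_mul !big_ord_recl big_ord0 /= /increasing eqxx /=.
  rewrite mul0r add0r addr0 mul1r /ad_coef /= subn1 /=.
  case: n => [|n]; first by rewrite /= /ncs_one eqxx bin0.
  by rewrite iterS /ncs_mul big_ord_recl big_ord0 eqxx /= mul0r addr0 bin0n.
have [a [d [sv h]]] := IH y.
case xy : (x < y)%N.
  exists a.+1, d; split=> [|[|n]]; [by rewrite addSn sv | by [] |].
  by rewrite ncs_pow_increasing_cons xy mul1r !h -natrD ad_coef_pascal ad_coefSS addnC.
exists a, d.+1; split=> [|[|n]]; [by rewrite addnS sv | by [] |].
by rewrite ncs_pow_increasing_cons xy mul0r addr0 h ad_coefSS.
Qed.

(** Up to sign, the right side is the Beta integral of t^d (1 - t)^a. Pascal's rule in a matches d!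
    a! / (a+d+1)! - (d+1)! a! / (a+d+2)! = d! (a+1)! / (a+d+2)!. *)
Lemma sum_log_coef K a d : (a + d + 1 < K)%N ->
  \sum_(n < K) log_coef R n * (ad_coef a d n)%:R =
  (-1) ^+ d * (d`! * a`!)%:R / (a + d + 1)`!%:R.
Proof.
have f0 m : m`!%:R != 0 :> R by rewrite pnatr_eq0 -lt0n fact_gt0.
elim: a d => [|a IH] d hK.
  have dK : (d.+1 < K)%N by lia.
  rewrite (bigD1 (Ordinal dK)) //= big1 ?addr0 => [|n nd].
    rewrite /ad_coef ltnSn subnn bin0 mulr1 /log_coef !exprS !mulN1r opprK.
    rewrite fact0 muln1 add0n addn1 factS natrM -mulrA; congr (_ * _).
    by rewrite invfM mulrCA divff ?mulr1.
  rewrite /ad_coef; case: ifP; rewrite ?mulr0 // => dn; rewrite bin0n.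
  case: eqP; rewrite ?mulr0 // => e; case/eqP: nd; apply: val_inj => /=; lia.
under eq_bigr => n _ do rewrite ad_coef_pascal natrD mulrDr.
rewrite big_split /= !IH; try lia.
rewrite !addn1 addSn addnS exprS mulN1r !factS !natrM.
have := f0 (a + d)%N; have s0 m : m.+1%:R != 0 :> R by rewrite pnatr_eq0.
have := s0 (a + d)%N; have := s0 (a + d).+1.
rewrite -![in X in X -> _]natr1 -!natr1 !natrD => h1 h2 h3.
by field; rewrite ?h1 ?h2 ?h3.
Qed.

Lemma bin_le_exp2 n m : ('C(n, m) <= 2 ^ n)%N.
Proof.
elim: n m => [|n IH] [|m] //; first by rewrite bin0 expn_gt0.
by rewrite binS expnS mul2n -addnn leq_add.
Qed.

Lemma log_prod_exp_ge k w : perm_eq w (iota 0 k.+1) ->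
  (k.+1%:R * 2 ^+ k)^-1 <= `|log_prod_exp R k.+1 w|.
Proof.
move=> pw; rewrite log_prod_expE //.
case: w pw (perm_size pw) => // x v _ /= [sv].
have [a [d [ad h]]] := ncs_pow_increasing x v.
under eq_bigr => n _ do rewrite h.
rewrite sum_log_coef; last by rewrite ad sv size_iota; lia.
rewrite -mulrA normrM normrX normrN1 expr1n mul1r ger0_norm ?divr_ge0 ?ler0n //.
rewrite ad sv size_iota addn1 factS.
have p0 m : 0 < m`!%:R :> R by rewrite ltr0n fact_gt0.
have kE : k = (a + d)%N by rewrite ad sv size_iota.
have fk : k`! = ('C(k, d) * (d`! * a`!))%N.
  by rewrite -(@bin_fact k d) kE ?leq_addl // addnK.
rewrite -[leLHS]mul1r ler_pdivrMr ?mulr_gt0 ?ltr0n ?exprn_gt0 //.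
rewrite mulrAC ler_pdivlMr ?ltr0n ?muln_gt0 ?fact_gt0 // mul1r.
rewrite -natrX -!natrM ler_nat [leqRHS]mulnCA leq_mul2l /= fk.
by rewrite [leqRHS]mulnC leq_mul2r bin_le_exp2 orbT.
Qed.

End Coefficients.

(** * The convergence radius *)

Section Radius.
Variable R : realType.

Lemma lie_l1norm_le P c : lcost P c -> (lie_l1norm (P : free_algebra R) <= c%:E)%E.
Proof.
case=> s ds sc; apply: (@le_trans _ _ (\sum_(p <- s) `|p.1|)%:E).
  by apply: ereal_inf_lbound; exists s.
by rewrite lee_fin.
Qed.

Lemma lie_l1norm_ge0 P : (0 <= lie_l1norm (P : free_algebra R))%E.
Proof.
by apply: le_ereal_inf_tmp => _ [s _ <-]; rewrite lee_fin; apply: sumr_ge0.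
Qed.

Lemma ThetaLie_ge0 k : (0 <= ThetaLie R k)%E.
Proof.
case: k => // k; apply: mule_ge0; last exact: lie_l1norm_ge0.
by rewrite lee_fin invr_ge0 ler0n.
Qed.

Lemma ThetaLie_ge k : ((k.+1%:R * 4 ^+ k)^-1%:E <= ThetaLie R k.+1)%E.
Proof.
pose c := log_prod_exp R k.+1; pose e w := Num.sg (c w).
have e1 w : `|e w| <= 1 by rewrite normr_sg lern1 leq_b1.
have pe : k.+1`!%:R * (k.+1%:R * 2 ^+ k)^-1 <= pairing e k.+1 (magnus_commutator R k.+1).
  rewrite pairing_sum big_seq.
  rewrite (eq_bigr (fun w => `|c w|)) => [|w]; last first.
    by rewrite mem_permutations pairing_word => ->; rewrite /e -normrEsg.
  rewrite -(size_iota 0 k.+1) -size_permutations ?iota_uniq // size_iota.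
  rewrite -sum1_size natr_sum mulr_suml big_seq; apply: ler_sum => w.
  by rewrite mul1r mem_permutations; exact: log_prod_exp_ge.
have fk : 0 < k.+1`!%:R :> R by rewrite ltr0n fact_gt0.
have := pairing_le_l1norm k (magnus_commutator R k.+1) e1.
move/(@lee_wpmul2l _ (k.+1`!%:R^-1)%:E); rewrite lee_fin invr_ge0 ltW // => /(_ isT).
apply: le_trans; rewrite -EFinM lee_fin.
rewrite ler_pdivlMl // ler_pdivlMr ?exprn_gt0 //.
apply: le_trans (ler_norm _); apply: le_trans pe.
rewrite le_eqVlt -mulrA; apply/orP; left; apply/eqP; congr (_ * _).
rewrite !invfM -mulrA; congr (_ * _).
by rewrite (_ : 4 = 2 * 2) ?exprMn ?invfM -?mulrA ?mulVf ?mulr1 // -natrM.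
Qed.

Lemma bernoulli_ineq (e : R) m : 0 <= e -> 1 + m%:R * e <= (1 + e) ^+ m.
Proof.
move=> e0; elim: m => [|m IH]; first by rewrite mul0r addr0.
rewrite exprS; apply: (le_trans _ (ler_wpM2l _ IH)); last by rewrite addr_ge0.
have : 0 <= m%:R * e ^+ 2 by rewrite mulr_ge0 ?sqr_ge0.
rewrite -natr1; lra.
Qed.

Lemma geometric_unbounded (q s : R) : 1 < q ->
  ~ (forall k, q ^+ k.+1 / k.+1%:R <= s).
Proof.
move=> q1 h; pose e := q - 1.
have e0 : 0 < e by rewrite /e subr_gt0.
have qE : q = 1 + e by rewrite /e addrC subrK.
(* The even exponent allows squaring Bernoulli's inequality: q^(2m) >= (m e)^2, which exceeds 2 m s
   once m > 2 s / e^2. *)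
pose m := (Num.truncn (2 * s / e ^+ 2)).+1.
have ms : 2 * s / e ^+ 2 < m%:R by apply: truncnS_gt.
have m0 : 0 < m%:R :> R by rewrite ltr0n.
have : (m%:R * e) ^+ 2 <= q ^+ (2 * m).
  have eb : m%:R * e <= q ^+ m.
    by rewrite qE; apply: le_trans (bernoulli_ineq m (ltW e0)); rewrite lerDr.
  have me0 : 0 <= m%:R * e by rewrite mulr_ge0 // ltW.
  rewrite mulnC exprM; apply: lerXn2r => //; rewrite nnegrE //.
  exact: le_trans eb.
have := h (2 * m).-1; rewrite prednK ?muln_gt0 // ler_pdivrMr ?ltr0n ?muln_gt0 //.
move=> h1 h2; have := le_trans h2 h1; apply/negP; rewrite -ltNge natrM.
move: ms; rewrite ltr_pdivrMr ?exprn_gt0 // => ms.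
have -> : (m%:R * e) ^+ 2 = m%:R * (m%:R * e ^+ 2) by ring.
have -> : s * (2%:R * m%:R) = m%:R * (2 * s) by ring.
by rewrite ltr_pM2l.
Qed.

(** Convergence at some r > 4 bounds every term by the sum, so (r/4)^(k+1) / (k+1) would be bounded
    by a quarter of the sum. *)
Lemma CLie_le4 : (CLie R <= 4%:E)%E.
Proof.
apply: ge_ereal_sup => _ [r [r0 fin] <-]; rewrite lee_fin leNgt; apply/negP => r4.
set S := (X in (X < _)%E) in fin.
have term k : ((`|ThetaLie R k| * (r ^+ k)%:E) <= S)%E.
  apply: (@le_trans _ _ (\sum_(0 <= i < k.+1) (`|ThetaLie R i| * (r ^+ i)%:E)))%E.
    rewrite big_nat_recr //= leeDr // sume_ge0 // => i _.
    by rewrite mule_ge0 ?abse_ge0 // lee_fin exprn_ge0.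
  by apply: nneseries_lim_ge => n _ _; rewrite mule_ge0 ?abse_ge0 // lee_fin exprn_ge0.
have Sfin : S \is a fin_num.
  rewrite ge0_fin_numE //; apply: le_trans (term 0%N).
  by rewrite mule_ge0 ?abse_ge0 // lee_fin exprn_ge0.
apply: (@geometric_unbounded (r / 4) (fine S / 4)); first by rewrite ltr_pdivlMr ?mul1r.
move=> k; rewrite ler_pdivlMr // -lee_fin fineK //.
apply: le_trans (term k.+1); rewrite gee0_abs ?ThetaLie_ge0 //.
apply: le_trans (lee_wpmul2r _ (ThetaLie_ge k)); last by rewrite lee_fin exprn_ge0.
rewrite -EFinM lee_fin le_eqVlt; apply/orP; left; apply/eqP.
rewrite expr_div_n [4 ^+ k.+1]exprS !invfM; set a := k.+1%:R^-1; set b := (4 ^+ k)^-1.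
by move: a b (r ^+ k.+1) => a b c; field.
Qed.

Lemma nneg_iter N M : nneg (iter N (next M) (0, 0, 0) : state R).
Proof. by elim: N => [|N IH]; [exact: nneg0|apply: nneg_next]. Qed.

(** After N iterations the degrees up to N are covered. The cut of the Bernoulli series at 4 (N + 1)
    is harmless there, as ad(Z)^n has order n, and it fits the grouping by four. *)
Lemma ThetaLie_le N k : (k <= N)%N ->
  (ThetaLie R k <=
   ((iter N (next (4 * N.+1)) (0, 0, 0) : state R).1.1`_k)%:E)%E.
Proof.
move=> kN; case: k kN => [|k] kN.
  by rewrite lee_fin; case: (nneg_iter N (4 * N.+1)).
have NM : (N <= 4 * N.+1)%N by lia.
have [m1 _ _] := @majorized_iter R _ _ NM.
have := m1 (rev (iota 0 k.+1)); rewrite size_rev size_iota => /(_ kN).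
rewrite magnus_rev_iota => /lie_l1norm_le h.
have fk : 0 < k.+1`!%:R :> R by rewrite ltr0n fact_gt0.
rewrite /ThetaLie; apply: le_trans (lee_wpmul2l _ h) _.
  by rewrite lee_fin invr_ge0 ltW.
by rewrite -EFinM lee_fin mulKf // gt_eqF.
Qed.

(** The partial sum of length n is compared with the n-th iterate, whose further terms are
    nonnegative and whose value is bounded uniformly in n. *)
Lemma ThetaLie_series_le :
  (\sum_(0 <= k <oo) (`|ThetaLie R k| * ((2428 / 1000) ^+ k)%:E) <= 9%:E)%E.
Proof.
have := @iter_bounded R; have : 0 <= 2428 / 1000 :> R by rewrite divr_ge0 ?ler0n.
move: (2428 / 1000) => r r0 bnd.
apply: lime_le.
  by apply: is_cvg_nneseries => n _ _; rewrite mule_ge0 ?abse_ge0 // lee_fin exprn_ge0.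
apply: nearW => n; pose p := (iter n (next (4 * n.+1)) (0, 0, 0) : state R).1.1.
apply: (@le_trans _ _ (\sum_(0 <= k < n) (p`_k * r ^+ k)%:E)%E).
  rewrite !big_mkord; apply: lee_sum => k _; rewrite gee0_abs ?ThetaLie_ge0 // EFinM.
  apply: lee_wpmul2r; first by rewrite lee_fin exprn_ge0.
  by apply: ThetaLie_le; exact: ltnW.
rewrite sumEFin lee_fin; apply: le_trans (bnd n n).
rewrite -/p (horner_coef_wide _ (leq_maxl (size p) n)) -(big_mkord xpredT (fun k => p`_k * r ^+ k)).
rewrite (big_cat_nat (leq0n n) (leq_maxr (size p) n)) /= lerDl sumr_ge0 // => i _.
by rewrite mulr_ge0 ?exprn_ge0 //; case: (nneg_iter n (4 * n.+1)).
Qed.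

Lemma CLie_gt : ((2427 / 1000)%:E < CLie R)%E.
Proof.
apply: (@lt_le_trans _ _ (2428 / 1000)%:E).
  have h : 0 < 1000%:R^-1 :> R by rewrite invr_gt0 ltr0n.
  by rewrite lte_fin (ltr_pM2r h) ltr_nat.
apply: ereal_sup_ubound; exists (2428 / 1000); last by [].
split; first by rewrite divr_ge0 ?ler0n.
exact: le_lt_trans ThetaLie_series_le (ltry _).
Qed.

End Radius.

Unset Implicit Arguments.

Theorem mainTheorem1 (R : realType) :
  ((2427 / 1000)%:E < CLie R)%E /\ (CLie R <= 4%:E)%E.
Proof. by split; [exact: CLie_gt|exact: CLie_le4]. Qed.
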